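(* Let $\mathcal{C}$ be a cyclic attractor (of full rank or not) in a binary Glass network in $\mathbb{R}^n$ with all thresholds equal to $0$. Then one of the following two possibilities holds: (1) $\mathcal{C}$ has a unique and asymptotically stable periodic orbit; (2) all trajectories in $\mathcal{C}$ converge to the spine $\mathcal{S}(\mathcal{C})$ (degenerate periodic orbits).
   Context: Binary Glass network centred at $0$: each of the $n$ variables has the single threshold $0$. Regions are the $2^n$ open orthants of $\mathbb R^n$; a wall is the common (relatively open) facet of two adjacent orthants, i.e. a set where one coordinate is $0$ and each other coordinate has a fixed nonzero sign. To each orthant $\mathcal O$ is assigned a focal point $f\in\mathbb R^n$ and inside $\mathcal O$ the dynamics is $\dot y=-y+f$, so $y(t)=f+(y(0)-f)e^{-t}$. Standing assumption: no focal point has a zero coordinate. Cycles. A cycle of regions is a sequence of pairwise distinct orthants $\mathcal O_1\to\dots\to\mathcal O_k\to\mathcal O_{k+1}=\mathcal O_1$ with consecutive ones adjacent across a wall $\mathcal W_i$ between $\mathcal O_i$ and $\mathcal O_{i+1}$ ($\mathcal W_0=\mathcal W_k$), such that, if $\mathcal W_i$ lies in $\{x_m=0\}$ and $f^i,f^{i+1}$ are the focal points of $\mathcal O_i,\mathcal O_{i+1}$, then $f^i_m,f^{i+1}_m$ both have the sign of the $m$-th coordinate on $\mathcal O_{i+1}$. On $\mathcal W_i$ the dynamics is the continuous extension of that of $\mathcal O_{i+1}$, so a trajectory reaching $\mathcal W_i$ from $\mathcal O_i$ continues into $\mathcal O_{i+1}$. A cyclic attractor is a cycle of regions, written $\mathcal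 C=\bigcup_i\mathcal O_i$ (together with the walls $\mathcal W_i$), such that for every $i$ all trajectories starting in $\mathcal O_i$ unambiguously enter $\mathcal O_{i+1}$ next. It is full-rank if every variable switches (crosses $0$) at least once along the cycle. Its spine is $\mathcal S(\mathcal C)=\bigcap_{i=0}^{k-1}\overline{\mathcal W_i}$. Periodic orbits. A (non-degenerate) periodic orbit of $\mathcal C$ is a closed trajectory of positive period in $\mathcal C$; equivalently it corresponds to a fixed point, in the wall $\mathcal W_0$, of the Poincaré return map $M:\mathcal W_0\to\mathcal W_0$ obtained by following trajectories once around the cycle, and (asymptotic) stability of the periodic orbit corresponds to that of the fixed point of $M$ on $\mathcal W_0$. A degenerate periodic orbit is one consisting of a single point of the spine. Trajectories are considered on their maximal forward time interval along the cycle, and convergence to the spine (which may occur in finite time) is meant as time tends to the right end of that interval. *)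

(* Defs.v *)
From HB Require Import structures.
From mathcomp Require Import all_boot all_order all_algebra.
From mathcomp Require Import all_classical all_reals all_analysis.
Import Order.TTheory GRing.Theory Num.Theory.
Import numFieldNormedType.Exports.

Set Implicit Arguments.
Unset Strict Implicit.
Unset Printing Implicit Defensive.

Local Open Scope classical_set_scope.
Local Open Scope ring_scope.

Section GlassNetwork.
Variables (R : realType) (n : nat).

(* The sign pattern of an orthant: [true] stands for a positive coordinate. *)
Definition sign_pattern := {ffun 'I_n -> bool}.

Definition has_sign (b : bool) (a : R) : Prop := if b then 0 < a else a < 0.

Definition orthant (s : sign_pattern) : set 'rV[R]_n :=
  [set x | forall j, has_sign (s j) (x 0 j)].

(* The facet in {x_m = 0} common to the orthant [s] and the one that differs
   from it in the sign of the coordinate [m] only. *)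
Definition wall (s : sign_pattern) (m : 'I_n) : set 'rV[R]_n :=
  [set x | x 0 m = 0 /\ forall j, j != m -> has_sign (s j) (x 0 j)].

Record glass_network := GlassNetwork {
  focal : sign_pattern -> 'rV[R]_n;
  focal_neq0 : forall s j, focal s 0 j != 0
}.

(* The solution of y' = - y + f starting at x. *)
Definition flow (f x : 'rV[R]_n) (t : R) : 'rV[R]_n :=
  f + expR (- t) *: (x - f).

(* Regions are indexed modulo the length k.+1 by 'I_k.+1, with cyclic successor
   [ordS]; [switch i] is the variable that changes sign from the region [i] to
   the region [ordS i]. *)
Record region_cycle k := RegionCycle {
  region : 'I_k.+1 -> sign_pattern;
  switch : 'I_k.+1 -> 'I_n
}.

Section Cycle.
Variables (N : glass_network) (k : nat) (C : region_cycle k).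

Definition cycle_orthant (i : 'I_k.+1) : set 'rV[R]_n := orthant (region C i).

Definition cycle_wall (i : 'I_k.+1) : set 'rV[R]_n :=
  wall (region C i) (switch C i).

Definition cycle_focal (i : 'I_k.+1) : 'rV[R]_n := focal N (region C i).

Record is_cycle : Prop := IsCycle {
  cycle_distinct : injective (region C);
  cycle_adjacent : forall i j,
    (region C (ordS i) j != region C i j) = (j == switch C i);
  cycle_exit : forall i,
    has_sign (region C (ordS i) (switch C i)) (cycle_focal i 0 (switch C i));
  cycle_enter : forall i,
    has_sign (region C (ordS i) (switch C i))
             (cycle_focal (ordS i) 0 (switch C i))
}.

(* By [cycle_enter], a trajectory on the wall [i] proceeds into the region
   [ordS i]. *)
Definition cyclic_attractor : Prop :=
  is_cycle /\
  forall i x, cycle_orthant i x ->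
    exists2 t : R, 0 < t &
      (forall s, 0 <= s < t -> cycle_orthant i (flow (cycle_focal i) x s)) /\
      cycle_wall i (flow (cycle_focal i) x t).

Definition spine : set 'rV[R]_n :=
  \bigcap_(i in [set: 'I_k.+1]) closure (cycle_wall i).

(* A trajectory in the cycle starts in the region [i], or on the wall through
   which this region is entered. The switching times are t 1 < t 2 < ..., and
   t 0 = 0. Only the values of [y] on [0, sup t) are meaningful. *)
Record trajectory (i : 'I_k.+1) (t : nat -> R) (y : R -> 'rV[R]_n) : Prop :=
  Trajectory {
  traj_start : cycle_orthant i (y 0) \/ cycle_wall (ord_pred i) (y 0);
  traj_time0 : t 0%N = 0;
  traj_time_lt : forall j, t j < t j.+1;
  traj_flow : forall j s, t j <= s <= t j.+1 ->
    y s = flow (cycle_focal (iter j (@ordS _) i)) (y (t j)) (s - t j);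
  traj_region : forall j s, t j < s < t j.+1 ->
    cycle_orthant (iter j (@ordS _) i) (y s);
  traj_wall : forall j, cycle_wall (iter j (@ordS _) i) (y (t j.+1))
}.

(* The right end of the maximal time interval: when it is finite, the
   switching times accumulate there. *)
Definition end_time (t : nat -> R) : \bar R := ereal_sup (range (EFin \o t)).

(* The distance of y s to the spine tends to 0 as s tends to the end time. *)
Definition converges_to_spine (t : nat -> R) (y : R -> 'rV[R]_n) : Prop :=
  forall e : R, 0 < e ->
    exists s0 : R, [/\ 0 <= s0, (s0%:E < end_time t)%E &
      forall s, s0 <= s -> (s%:E < end_time t)%E ->
        exists2 z, spine z & `|y s - z| < e].

Definition periodic_orbit (G : set 'rV[R]_n) : Prop :=
  exists i t y (p : R),
    [/\ trajectory i t y, end_time t = +oo%E, 0 < p,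
        forall s, 0 <= s -> y (s + p) = y s &
        G = y @` [set s | 0 <= s]].

Definition wall0 : set 'rV[R]_n := cycle_wall ord0.

(* A trajectory that starts on [wall0] is back there after k.+1 switchings. In
   a cycle 0 is not on [wall0], so the default value creates no fixed point. *)
Definition return_map (x : 'rV[R]_n) : 'rV[R]_n :=
  xget 0 [set x' | exists t y,
    [/\ wall0 x, trajectory (ordS ord0) t y, y 0 = x & x' = y (t k.+1)]].

Definition asymptotically_stable_on
    (W : set 'rV[R]_n) (M : 'rV[R]_n -> 'rV[R]_n) (q : 'rV[R]_n) : Prop :=
  (forall e : R, 0 < e ->
     \forall x \near within W (nbhs q), forall j, `|iter j M x - q| < e) /\
  (\forall x \near within W (nbhs q), iter j M x @[j --> \oo] --> q).

Definition stable_orbit (G : set 'rV[R]_n) : Prop :=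
  exists q, [/\ G q, wall0 q, return_map q = q &
                asymptotically_stable_on wall0 return_map q].

End Cycle.
End GlassNetwork.

(* Main.v *)
Require Import Defs.
From mathcomp Require Import all_boot all_order all_algebra.
From mathcomp Require Import all_classical all_reals all_analysis.
From mathcomp Require Import ring lra.
Import Order.TTheory GRing.Theory Num.Theory.
Import numFieldNormedType.Exports.

(** Every trajectory of a region of a cyclic attractor leaves through the same
wall. Hence the focal point of a region lies in the next region
([focal_sign]), and in the absolute coordinates [u_j = |x_j|] the crossing of a
region is a projective map [u |-> u B / (1 + u psi)] with [B] and [psi]
entrywise nonnegative: each coordinate but the exiting one receives a positive
multiple of the exiting coordinate ([absv_exit_point]). Such maps compose, so
the return map to the wall 0 is [F u = u A / (1 + u phi)] in absolute
coordinates ([absv_return_map]).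

Call a variable active if it switches somewhere in the cycle and is not the
variable vanishing on the wall 0. When an active variable switches, it feeds
all the others, so the rows of [A] at active variables are positive, and so is
[phi] there ([cycle_mx_positive]); on variables that never switch, [A] is the
identity. Let [lam] be the Perron root of the active block ([perron]).

If [lam <= 1], then [F^j u] is a numerator of order at most [lam^j] divided by
a denominator that grows at least like [1 + lam + ... + lam^(j-1)], up to a
factor, so the active coordinates tend to 0 ([subcritical_vanish]). As a single
crossing amplifies the switching coordinates by a bounded factor
([exists_transit_factor]), whole trajectories converge to the spine.

If [lam > 1], then the Perron vector extends to an eigenvector of [A]
([extend_eigenvector]); its multiple [q] with [1 + q phi = lam] is a fixed
point of [F]. The ratios [u_i / q_i] are averaged by [F] with weights bounded
below, so they become equal in the limit ([iter_ratio]); on multiples of [q]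
the dynamics is one-dimensional and attracted by [q]
([supercritical_attract]). Thus [q] attracts the wall 0 and is stable. A
periodic orbit meets the wall 0 in a point that is fixed by some iterate of the
return map, hence in [q] ([periodic_orbit_unique]). *)

Set Implicit Arguments.
Unset Strict Implicit.
Unset Printing Implicit Defensive.

Local Open Scope classical_set_scope.
Local Open Scope ring_scope.

(** * Perron vectors of positive matrices *)

Lemma finite_pos_lower_bound (R : realType) (I : finType) (B : pred I) (g : I -> R) :
  (forall i, B i -> 0 < g i) ->
  exists d, [/\ 0 < d, d <= 1 & forall i, B i -> d <= g i].
Proof.
move=> g_gt0; exists (\big[Num.min/1]_(i | B i) g i); split.
- by apply: lt_bigmin.
- exact: bigmin_le_id.
- by move=> i Bi; apply: bigmin_le_cond.
Qed.

Lemma finite_upper_bound (R : realType) (I : finType) (g : I -> R) :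
  exists b, 1 <= b /\ forall i, g i <= b.
Proof.
exists (\big[Num.max/1]_i g i); split; first exact: bigmax_ge_id.
by move=> i; apply: le_bigmax.
Qed.

Lemma row_mulmxE (R : realType) n (u : 'rV[R]_n) (A : 'M[R]_n) i :
  (u *m A) 0 i = \sum_l u 0 l * A l i.
Proof. by rewrite mxE. Qed.

Lemma continuous_coef (R : realType) n (i : 'I_n) :
  continuous (fun u : 'rV[R]_n => u 0 i).
Proof. exact: coord_continuous. Qed.

Section Perron.
Variables (R : realType) (n : nat) (B : pred 'I_n) (A : 'M[R]_n).
Hypothesis B_nonempty : exists l, B l.
Hypothesis A_gt0 : forall l i, B l -> B i -> 0 < A l i.

Definition unit_simplex : set 'rV[R]_n :=
  [set u | [/\ forall i, 0 <= u 0 i, forall i, ~~ B i -> u 0 i = 0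
             & \sum_i u 0 i = 1]].

(** The Collatz-Wielandt pairs. The Perron root is the largest first component;
keeping the value and the vector together makes the set closed, so that this
maximum is a maximum of a continuous function on a compact set. *)
Definition sub_eigen_pair : set (R * 'rV[R]_n) :=
  [set p | unit_simplex p.2 /\ forall i, B i -> p.1 * p.2 0 i <= (p.2 *m A) 0 i].

Lemma unit_simplex_le1 u i : unit_simplex u -> u 0 i <= 1.
Proof.
case=> u_ge0 _ <-; rewrite (bigD1 i) //= lerDl.
exact: sumr_ge0.
Qed.

Let Amax : R := \sum_i \sum_l `|A l i|.

Lemma sub_eigen_pair_bound p : sub_eigen_pair p -> p.1 <= Amax.
Proof.
case: p => r u [] /= uS ru_le; have [u_ge0 uB u1] := uS.
rewrite -[r]mulr1 -u1 mulr_sumr; apply: ler_sum => i _.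
have [Bi|/uB ->] := boolP (B i); last first.
  by rewrite mulr0; apply: sumr_ge0.
apply: (le_trans (ru_le _ Bi)); rewrite row_mulmxE; apply: ler_sum => l _.
apply: le_trans (ler_norm _) _; rewrite normrM -[leRHS]mul1r.
apply: ler_wpM2r => //; rewrite ger0_norm //; exact: unit_simplex_le1.
Qed.

Lemma compact_sub_eigen_pair :
  compact (sub_eigen_pair `&` [set p | 0 <= p.1]).
Proof.
pose box : set ('rV[R]_n) := [set u | forall i, `[0, 1]%classic (u ord0 i)].
have cbox : compact (`[0, Amax]%classic `*` box).
  apply: compact_setX; first exact: segment_compact.
  by apply: (@rV_compact R n (fun=> `[0, 1]%classic)) => i; exact: segment_compact.
apply: (subclosed_compact _ cbox) => [|[r u] [/[dup] ru [uS _]] /= r0]; last first.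
  split => /=; first by rewrite in_itv /= r0; exact: sub_eigen_pair_bound ru.
  move=> i /=; rewrite in_itv /= unit_simplex_le1 // andbT; by case: uS.
have coefc i : continuous (fun p : R * 'rV[R]_n => p.2 0 i).
  move=> p; apply: (@continuous_comp _ _ _ snd (fun u : 'rV[R]_n => u 0 i)).
    exact: cvg_snd.
  exact: continuous_coef.
have sumc (c : 'I_n -> R) : continuous (fun p : R * 'rV[R]_n => \sum_l p.2 0 l * c l).
  move=> p; apply: cvg_big => [|l _]; first exact: add_continuous.
  by apply: cvgM; [exact: coefc | exact: cvg_cst].
have fstc : continuous (fun p : R * 'rV[R]_n => p.1) by move=> p; exact: cvg_fst.
have -> : sub_eigen_pair `&` [set p : R * 'rV[R]_n | 0 <= p.1] =
  [set p : R * 'rV[R]_n | 0 <= p.1] `&` (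
  (\bigcap_(i in setT) [set p : R * 'rV[R]_n | 0 <= p.2 0 i]) `&` (
  (\bigcap_(i in [set i | ~~ B i]) [set p : R * 'rV[R]_n | p.2 0 i = 0]) `&` (
  [set p : R * 'rV[R]_n | \sum_l p.2 0 l * 1 = 1] `&`
  \bigcap_(i in [set i | B i])
    [set p : R * 'rV[R]_n | 0 <= \sum_l p.2 0 l * A l i - p.1 * p.2 0 i]))).
  apply/seteqP; split=> [p [[[h1 h2 h3] h4] h5]|p [h5 [h1 [h2 [h3 h4]]]]].
    split=> //; split; first by move=> i _; exact: h1.
    split; first by move=> i; exact: h2.
    split; first by rewrite /= -[RHS]h3; apply: eq_bigr => i _; rewrite mulr1.
    by move=> i /h4; rewrite /= row_mulmxE subr_ge0.
  split=> //; split; first split.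
  - by move=> i; apply: h1.
  - by move=> i; apply: h2.
  - by rewrite -[RHS]h3; apply: eq_bigr => i _; rewrite mulr1.
  - by move=> i /h4; rewrite /= row_mulmxE subr_ge0.
have closed_ge (f : R * 'rV[R]_n -> R) : continuous f -> closed [set p : R * 'rV[R]_n | 0 <= f p].
  by move=> fc; apply: (@preimage_closed _ _ f [set x | 0 <= x]).
have closed_eq1 (f : R * 'rV[R]_n -> R) c : continuous f -> closed [set p : R * 'rV[R]_n | f p = c].
  move=> fc; apply: (@preimage_closed _ _ f [set x | x = c]) => [p _|].
    exact: fc.
  exact: closed_eq.
apply: closedI; first exact: closed_ge.
apply: closedI; first by apply: closed_bigI => i _; apply: closed_ge.
apply: closedI; first by apply: closed_bigI => i _; apply: closed_eq1.
apply: closedI; first exact: closed_eq1.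
apply: closed_bigI => i _; apply: closed_ge => p; apply: cvgB; first exact: sumc.
by apply: cvgM; [exact: fstc | exact: coefc].
Qed.

(** A maximal pair [(lam, u)] is an eigenpair: if [lam u <> u A] somewhere, then
positivity of [A] makes [w = u A] satisfy [lam w < w A] everywhere, and [w]
admits a larger first component. *)
Theorem perron : exists (lam : R) (v : 'rV[R]_n),
  [/\ 0 < lam, forall i, B i -> 0 < v 0 i, forall i, ~~ B i -> v 0 i = 0
    & forall i, B i -> (v *m A) 0 i = lam * v 0 i].
Proof.
have [l0 Bl0] := B_nonempty.
have nonempty : (sub_eigen_pair `&` [set p | 0 <= p.1]) !=set0.
  exists (0, delta_mx 0 l0); split=> //=; split=> /=; first split.
  - by move=> i; rewrite mxE; case: (_ && _).
  - move=> i; rewrite mxE /= => Bi; case: eqP => // e.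
    by move: Bi; rewrite e Bl0.
  - rewrite (bigD1 l0) //= big1 ?addr0 ?mxE ?eqxx // => i /negbTE il.
    by rewrite mxE /= il.
  - move=> i Bi; rewrite mul0r row_mulmxE; apply: sumr_ge0 => l _.
    rewrite mxE /=; case: eqP => [->|]; last by rewrite mul0r.
    by rewrite mul1r ltW // A_gt0.
have fstc : {within sub_eigen_pair `&` [set p | 0 <= p.1], continuous (@fst R 'rV[R]_n)}.
  by apply: continuous_subspaceT => p; exact: cvg_fst.
have [[lam u] lamu_mem lam_max] := compact_EVT_max nonempty compact_sub_eigen_pair fstc.
have {}lam_max p : sub_eigen_pair p -> p.1 <= lam.
  move=> hp; have [p0|/ltW p0] := leP 0 p.1; first by apply: lam_max; rewrite inE.
  by apply: (le_trans p0); move: lamu_mem; rewrite inE => -[].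
move: lamu_mem; rewrite inE => -[[/= uS lamu] /= lam_ge0].
have [u_ge0 uB u1] := uS.
have [l1 [Bl1 ul1]] : exists l, B l /\ 0 < u 0 l.
  apply: contrapT => h; suff : \sum_i u 0 i = 0 by rewrite u1 => /eqP; rewrite oner_eq0.
  apply: big1 => i _; have [Bi|/uB//] := boolP (B i).
  apply/eqP; rewrite eq_le u_ge0 andbT leNgt; apply/negP => ui.
  by apply: h; exists i.
(* Restricting [u *m A] to the block keeps [w], once normalised, in the simplex. *)
pose w : 'rV[R]_n := \row_i (if B i then (u *m A) 0 i else 0).
have wE i : B i -> w 0 i = (u *m A) 0 i by move=> Bi; rewrite mxE Bi.
have wN i : ~~ B i -> w 0 i = 0 by move=> /negbTE Bi; rewrite mxE Bi.
have term_ge0 i l : B i -> 0 <= u 0 l * A l i.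
  move=> Bi; have [Bl|/uB ->] := boolP (B l); last by rewrite mul0r.
  by rewrite mulr_ge0 // ltW // A_gt0.
have w_gt0 i : B i -> 0 < w 0 i.
  move=> Bi; rewrite wE // row_mulmxE (bigD1 l1) //=.
  rewrite ltr_pwDl ?mulr_gt0 ?A_gt0 //; apply: sumr_ge0 => l _; exact: term_ge0.
suff eig i : B i -> lam * u 0 i = w 0 i.
  have pos i : B i -> 0 < lam /\ 0 < u 0 i.
    move=> Bi; have := w_gt0 _ Bi; rewrite -eig //.
    move: lam_ge0 (u_ge0 i); rewrite !le_eqVlt => /orP[/eqP <-|h1]; first by rewrite mul0r ltxx.
    by move=> /orP[/eqP <-|h2 //]; rewrite mulr0 ltxx.
  exists lam, u; split=> [|i /pos[]//|//|i Bi]; first by case: (pos _ Bl0).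
  by rewrite -wE // eig.
move=> Bi; apply/eqP; rewrite eq_le wE // lamu //= leNgt; apply/negP => lt_i.
have w_ge0 j : 0 <= w 0 j.
  by have [Bj|/wN ->//] := boolP (B j); rewrite ltW // w_gt0.
have gap j : B j -> 0 < (w *m A) 0 j - lam * w 0 j.
  move=> Bj; rewrite (wE _ Bj) !row_mulmxE mulr_sumr -sumrB (bigD1 i) //=.
  rewrite mulrA -mulrBl ltr_pwDl ?mulr_gt0 ?A_gt0 ?subr_gt0 ?wE //.
  apply: sumr_ge0 => l _; rewrite mulrA -mulrBl.
  have [Bl|nBl] := boolP (B l); last by rewrite wN // uB // mulr0 subrr mul0r.
  by rewrite mulr_ge0 ?subr_ge0 ?wE ?lamu // ltW // A_gt0.
have [d [d_gt0 _ d_le]] :=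
  @finite_pos_lower_bound R _ B _ (fun j Bj => divr_gt0 (gap j Bj) (w_gt0 j Bj)).
have sw_gt0 : 0 < \sum_j w 0 j.
  rewrite (bigD1 l0) //= ltr_pwDl ?w_gt0 //; exact: sumr_ge0.
pose c := (\sum_j w 0 j)^-1.
have c_ge0 : 0 <= c by rewrite invr_ge0 ltW.
have cwE j : (c *: w) 0 j = c * w 0 j by rewrite mxE.
have : sub_eigen_pair (lam + d, c *: w).
  split=> /=; first split.
  - by move=> j; rewrite cwE mulr_ge0.
  - by move=> j /wN wj; rewrite cwE wj mulr0.
  - rewrite (eq_bigr (fun j => c * w 0 j)) => [|j _]; last exact: cwE.
    by rewrite -mulr_sumr mulVf // gt_eqF.
  - move=> j Bj; rewrite cwE -scalemxAl [leRHS]mxE mulrCA ler_wpM2l //.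
    have := d_le _ Bj; rewrite ler_pdivlMr ?w_gt0 // lerBrDl -mulrDl.
    by [].
move=> /lam_max /=; rewrite gerDl leNgt d_gt0 //.
Qed.

End Perron.

(** * Projective maps and eigenvectors *)

Lemma expr_small (R : realType) (c e : R) : 0 <= c < 1 -> 0 < e ->
  exists J, forall j, (J <= j)%N -> c ^+ j <= e.
Proof.
move=> /andP[c0 c1] e0.
have /cvgrPdist_le /(_ e e0) : (fun j => c ^+ j) @ \oo --> (0 : R).
  by apply: cvg_expr; rewrite ger0_norm.
case=> J _ HJ; exists J => j Jj; have := HJ j Jj.
by rewrite sub0r normrN; apply: le_trans; exact: ler_norm.
Qed.

Lemma expr_large (R : realType) (c M : R) : 1 < c ->
  exists J, forall j, (J <= j)%N -> M <= c ^+ j.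
Proof.
move=> c1; have c0 : 0 < c by lra.
have M0 : 0 < Num.max 1 M by rewrite lt_max ltr01.
have [||J HJ] := @expr_small R c^-1 (Num.max 1 M)^-1; last 1 first.
- exists J => j /HJ; rewrite exprVn lef_pV2 ?posrE ?exprn_gt0 //.
  by rewrite ge_max => /andP[].
- by rewrite invr_ge0 ltW //= invf_lt1.
- by rewrite invr_gt0.
Qed.

Section ProjectiveMap.
Variables (R : realType) (n : nat) (A : 'M[R]_n) (phi : 'cV[R]_n).
Hypothesis A_ge0 : forall l i, 0 <= A l i.
Hypothesis phi_ge0 : forall l, 0 <= phi l 0.

Definition weight (u : 'rV[R]_n) : R := (u *m phi) 0 0.

Definition proj_map (u : 'rV[R]_n) : 'rV[R]_n := (1 + weight u)^-1 *: (u *m A).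

(** Comparison of [u] with multiples of [v]: the ratios [u_i / v_i] lie in
[[a, b]], stated without division. *)
Definition between (B : pred 'I_n) (a b : R) (v u : 'rV[R]_n) :=
  forall i, B i -> a * v 0 i <= u 0 i <= b * v 0 i.

(** On such a block, the values of [u A] and of [u phi] depend on the block
coordinates of [u] only. *)
Definition closed_block (B : pred 'I_n) :=
  (forall l i, ~~ B l -> B i -> A l i = 0) /\ (forall l, ~~ B l -> phi l 0 = 0).

Definition nonneg (u : 'rV[R]_n) := forall i, 0 <= u 0 i.

Definition in_cone (B : pred 'I_n) (u : 'rV[R]_n) :=
  (forall i, B i -> 0 < u 0 i) /\ (forall i, ~~ B i -> u 0 i = 0).

Lemma in_cone_nonneg B u : in_cone B u -> nonneg u.
Proof. by case=> h1 h2 i; case: (boolP (B i)) => [/h1/ltW//|/h2 ->]. Qed.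

Lemma proj_mapE u i : proj_map u 0 i = (1 + weight u)^-1 * (u *m A) 0 i.
Proof. by rewrite mxE. Qed.

Lemma weightE u : weight u = \sum_l u 0 l * phi l 0.
Proof. by rewrite /weight mxE. Qed.

Lemma weightZ c u : weight (c *: u) = c * weight u.
Proof. by rewrite /weight -scalemxAl mxE. Qed.

Lemma weight_ge0 u : nonneg u -> 0 <= weight u.
Proof. by move=> u0; rewrite weightE; apply: sumr_ge0 => l _; rewrite mulr_ge0. Qed.

Lemma mulmx_nonneg u : nonneg u -> nonneg (u *m A).
Proof. by move=> u0 i; rewrite row_mulmxE; apply: sumr_ge0 => l _; rewrite mulr_ge0. Qed.

Lemma proj_map_nonneg u : nonneg u -> nonneg (proj_map u).
Proof.
move=> u0 i; rewrite mxE mulr_ge0 ?mulmx_nonneg // invr_ge0.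
by rewrite addr_ge0 // weight_ge0.
Qed.

Lemma iter_proj_map_nonneg u j : nonneg u -> nonneg (iter j proj_map u).
Proof. by move=> u0; elim: j => // j IH; exact: proj_map_nonneg. Qed.

Lemma denom_gt0 u : nonneg u -> 0 < 1 + weight u.
Proof. by move=> /weight_ge0; lra. Qed.

Lemma exists_between (B : pred 'I_n) (v u : 'rV[R]_n) :
  (forall i, B i -> 0 < v 0 i) -> (forall i, B i -> 0 < u 0 i) ->
  exists a b, [/\ 0 < a, a <= 1, 1 <= b & between B a b v u].
Proof.
move=> v0 u0.
have [a [a0 a1 Ha]] :=
  @finite_pos_lower_bound R _ B _ (fun i Bi => divr_gt0 (u0 i Bi) (v0 i Bi)).
have [b [b1 Hb]] := @finite_upper_bound R _ (fun i => u 0 i / v 0 i).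
exists a, b; split=> // i Bi; apply/andP; split.
  by rewrite -ler_pdivlMr ?v0 // Ha.
by rewrite -ler_pdivrMr ?v0.
Qed.

Lemma mulmx_block_le B (u w : 'rV[R]_n) i : closed_block B -> B i ->
  (forall l, B l -> u 0 l <= w 0 l) -> (u *m A) 0 i <= (w *m A) 0 i.
Proof.
move=> [cA _] Bi uw; rewrite !row_mulmxE; apply: ler_sum => l _.
have [Bl|Bl] := boolP (B l); first by rewrite ler_wpM2r // uw.
by rewrite cA // !mulr0.
Qed.

Lemma weight_block_le B (u w : 'rV[R]_n) : closed_block B ->
  (forall l, B l -> u 0 l <= w 0 l) -> weight u <= weight w.
Proof.
move=> [_ cphi] uw; rewrite !weightE; apply: ler_sum => l _.
have [Bl|Bl] := boolP (B l); first by rewrite ler_wpM2r // uw.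
by rewrite cphi // !mulr0.
Qed.

Section EigenBlock.
Variables (B : pred 'I_n) (v : 'rV[R]_n) (lam : R).
Hypothesis B_closed : closed_block B.
Hypothesis v_eigen : forall i, B i -> (v *m A) 0 i = lam * v 0 i.

Lemma between_mulmx a b u : between B a b v u ->
  between B (lam * a) (lam * b) v (u *m A) /\ a * weight v <= weight u <= b * weight v.
Proof.
move=> uv.
have lo l : B l -> (a *: v) 0 l <= u 0 l by move=> /uv /andP[]; rewrite mxE.
have hi l : B l -> u 0 l <= (b *: v) 0 l by move=> /uv /andP[]; rewrite mxE.
split=> [i Bi|]; last by rewrite -!weightZ !(weight_block_le B_closed).
have cE c : lam * c * v 0 i = ((c *: v) *m A) 0 i.
  by rewrite -scalemxAl mxE v_eigen // mulrCA mulrA.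
by rewrite !cE !(mulmx_block_le B_closed).
Qed.

(** The common denominator [D] of [j] iterations linearises the iteration:
[D F^j u] is [u A^j], and [D] is the sum [1 + u phi + ... + u A^(j-1) phi]. Both
are compared with what they would be for a multiple of the eigenvector. *)
Lemma iter_proj_map_bounds a b u j : nonneg u -> between B a b v u ->
  exists D, [/\ between B (lam ^+ j * a) (lam ^+ j * b) v (D *: iter j proj_map u),
    1 + a * weight v * (\sum_(i < j) lam ^+ i) <= D &
    D <= 1 + b * weight v * (\sum_(i < j) lam ^+ i)].
Proof.
move=> u0 uv; elim: j => [|j [D [IH Dlo Dhi]]].
  exists 1; rewrite /= scale1r big_ord0 !mulr0 !addr0 !expr0 !mul1r.
  by split; [exact: uv|exact: lexx|exact: lexx].
set x := iter j proj_map u in IH *.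
have x0 : 0 < 1 + weight x by apply: denom_gt0; exact: iter_proj_map_nonneg.
have [step /andP[wlo whi]] := between_mulmx IH.
exists (D + weight (D *: x)); rewrite iterS -/x /proj_map big_ord_recr /=; split.
- rewrite weightZ -[X in X + _]mulr1 -mulrDr scalerA mulfK ?gt_eqF //.
  by rewrite scalemxAl !exprS -!(mulrA lam).
- by rewrite mulrDr addrA lerD // mulrC mulrA.
- by rewrite mulrDr addrA lerD // mulrC mulrA.
Qed.

End EigenBlock.

Section Contraction.
Variables (B : pred 'I_n) (v : 'rV[R]_n) (lam : R) (l0 : 'I_n) (d : R).
Hypothesis B_closed : closed_block B.
Hypothesis v_eigen : forall i, B i -> (v *m A) 0 i = lam * v 0 i.
Hypothesis lam_gt0 : 0 < lam.
Hypothesis v_gt0 : forall i, B i -> 0 < v 0 i.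
Hypothesis Bl0 : B l0.
Hypothesis d01 : 0 < d <= 1.
Hypothesis minor : forall i, B i -> d * (lam * v 0 i) <= v 0 l0 * A l0 i.

(** Doeblin contraction. The ratios of [u A] to [lam v] are averages of the
ratios of [u] to [v], each giving weight at least [d] to the ratio at [l0]; so
the interval that contains them shrinks by the factor [1 - d]. *)
Lemma ratio_step a b u : between B a b v u ->
  exists a' b', [/\ a <= a', b' <= b, b' - a' = (1 - d) * (b - a) &
    between B (lam * a') (lam * b') v (u *m A)].
Proof.
move=> uv; have [d0 d1] := andP d01.
pose g := u 0 l0 / v 0 l0.
have ug : u 0 l0 = g * v 0 l0 by rewrite divfK // gt_eqF // v_gt0.
have /andP[ag gb] : a <= g <= b.
  by have := uv _ Bl0; rewrite ug !ler_pM2r ?v_gt0.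
exists (a + d * (g - a)), (b - d * (b - g)); split.
- by rewrite lerDl mulr_ge0 // ?subr_ge0 // ltW.
- by rewrite gerBl mulr_ge0 // ?subr_ge0 // ltW.
- ring.
have main (c : R) (w : 'rV[R]_n) i : B i -> (forall l, B l -> 0 <= w 0 l) ->
    w 0 l0 = c * v 0 l0 -> 0 <= c -> lam * (d * c) * v 0 i <= (w *m A) 0 i.
  move=> Bi w0 wl0 c0; rewrite row_mulmxE (bigD1 l0) //= wl0 -[X in _ <= X + _]mulrA.
  have := ler_wpM2l c0 (minor Bi) => h.
  have -> : lam * (d * c) * v 0 i = c * (d * (lam * v 0 i)) by ring.
  apply: (le_trans h); rewrite lerDl; apply: sumr_ge0 => l _.
  have [Bl|Bl] := boolP (B l); first by rewrite mulr_ge0 // w0.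
  by rewrite (proj1 B_closed) // mulr0.
have mulB c i : B i -> ((c *: v) *m A) 0 i = lam * c * v 0 i.
  by move=> Bi; rewrite -scalemxAl mxE v_eigen // mulrCA mulrA.
move=> i Bi; apply/andP; split.
- have : lam * (d * (g - a)) * v 0 i <= ((u - a *: v) *m A) 0 i.
    apply: main => // [l Bl||]; last by rewrite subr_ge0.
      by rewrite !mxE subr_ge0; case/andP: (uv _ Bl).
    by rewrite !mxE ug; ring.
  have -> : ((u - a *: v) *m A) 0 i = (u *m A) 0 i - lam * a * v 0 i.
    by rewrite mulmxBl -(mulB a) // [LHS]mxE [X in _ + X]mxE.
  by rewrite lerBrDr => h; rewrite mulrDr mulrDl addrC.
- have : lam * (d * (b - g)) * v 0 i <= ((b *: v - u) *m A) 0 i.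
    apply: main => // [l Bl||]; last by rewrite subr_ge0.
      by rewrite !mxE subr_ge0; case/andP: (uv _ Bl).
    by rewrite !mxE ug; ring.
  have -> : ((b *: v - u) *m A) 0 i = lam * b * v 0 i - (u *m A) 0 i.
    by rewrite mulmxBl -(mulB b) // [LHS]mxE [X in _ + X]mxE.
  by rewrite lerBrDr => h; rewrite mulrBr mulrBl lerBrDr addrC.
Qed.

(** Dividing by the denominator changes both ends of the interval of ratios by
the same factor, so it is the length relative to the lower end that decreases
geometrically under the projective map. *)
Lemma iter_ratio a b u j : nonneg u -> 0 < a -> between B a b v u ->
  exists a' b', [/\ 0 < a', b' - a' <= (1 - d) ^+ j * ((b - a) / a) * a' &
    between B a' b' v (iter j proj_map u)].
Proof.
move=> u0 a0 uv; have [d0 d1] := andP d01.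
have rho_ge0 : 0 <= (b - a) / a.
  apply: divr_ge0; last exact: ltW.
  rewrite subr_ge0 -(ler_pM2r (v_gt0 Bl0)).
  by have /andP[h1] := uv _ Bl0; exact: le_trans.
elim: j => [|j [a1 [b1 [a10 IH bet]]]].
  exists a, b; rewrite expr0 mul1r divfK; last by rewrite gt_eqF.
  by split; [exact: a0|exact: lexx|exact: uv].
have w0 : 0 < 1 + weight (iter j proj_map u).
  by apply: denom_gt0; exact: iter_proj_map_nonneg.
have [a2 [b2 [a12 b12 gap bet2]]] := ratio_step bet.
set x := iter j proj_map u in w0 bet bet2 *.
have c0 : 0 < lam / (1 + weight x) by rewrite divr_gt0.
exists (lam / (1 + weight x) * a2), (lam / (1 + weight x) * b2); split.
- by rewrite mulr_gt0 //; lra.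
- rewrite -mulrBr gap [leRHS]mulrCA ler_pM2l // exprS -2!(mulrA (1 - d)).
  rewrite ler_wpM2l ?subr_ge0 //; apply: (le_trans IH); rewrite ler_wpM2l //.
  by rewrite mulr_ge0 ?exprn_ge0 ?subr_ge0.
- move=> i Bi; rewrite iterS -/x /proj_map mxE.
  have /andP[h1 h2] := bet2 i Bi.
  rewrite -!mulrA ![lam * (_^-1 * _)]mulrCA !ler_pM2l ?invr_gt0 //.
  by rewrite !mulrA h1 h2.
Qed.

End Contraction.

End ProjectiveMap.

Lemma proj_map_comp (R : realType) n (A B : 'M[R]_n) (phi psi : 'cV[R]_n) u :
  1 + weight phi u != 0 ->
  proj_map B psi (proj_map A phi u) = proj_map (A *m B) (phi + A *m psi) u.
Proof.
move=> w0; rewrite {1}/proj_map.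
have -> : 1 + weight psi (proj_map A phi u) =
    (1 + weight (phi + A *m psi) u) / (1 + weight phi u).
  have -> : weight (phi + A *m psi) u = weight phi u + weight psi (u *m A).
    by rewrite /weight mulmxDr mulmxA mxE.
  by rewrite /proj_map weightZ; field; exact: w0.
by rewrite /proj_map -scalemxAl scalerA mulmxA invfM invrK mulfK.
Qed.

(** * Dichotomy for projective maps *)

Section Asymptotics.
Variables (R : realType) (n : nat) (A : 'M[R]_n) (phi : 'cV[R]_n).
Hypothesis A_ge0 : forall l i, 0 <= A l i.
Hypothesis phi_ge0 : forall l, 0 <= phi l 0.

Local Notation F := (proj_map A phi).
Local Notation weight := (weight phi).

(** Bounds [lam^j b] for the numerator and [a w (1 + ... + lam^(j-1))] for the
denominator, with [w] the weight of [v], leave [b / (a w j)] times [v], because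
each term of that sum is at least [lam^j]. *)
Lemma subcritical_vanish (B : pred 'I_n) (v u : 'rV[R]_n) (lam : R) :
  closed_block A phi B -> (forall i, B i -> (v *m A) 0 i = lam * v 0 i) ->
  0 < lam <= 1 -> (forall i, B i -> 0 < v 0 i) -> 0 < weight v ->
  nonneg u -> (forall i, B i -> 0 < u 0 i) ->
  forall e, 0 < e -> exists J, forall j, (J <= j)%N ->
    forall i, B i -> iter j F u 0 i <= e.
Proof.
move=> cB eig /andP[lam0 lam1] v0 wv0 u0 uB e e0.
have [a [b [a0 a1 b1 uv]]] := exists_between v0 uB.
have [V [V1 vV]] := @finite_upper_bound R _ (fun i => v 0 i).
pose K := b * V / (a * weight v * e).
have awv0 : 0 < a * weight v by rewrite mulr_gt0.
have b0 : 0 < b by lra.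
have V0 : 0 < V by lra.
exists (Num.trunc K).+1 => j Jj i Bi.
have j0 : (0 < j)%N by apply: leq_ltn_trans Jj.
have Kj : K <= j%:R.
  have /andP[_ /ltW h] := trunc_itv (ltW (divr_gt0 (mulr_gt0 b0 V0) (mulr_gt0 awv0 e0))).
  by apply: (le_trans h); rewrite ler_nat.
have [D [bet Dlo _]] := iter_proj_map_bounds A_ge0 phi_ge0 cB eig j u0 uv.
have S_ge : j%:R * lam ^+ j <= \sum_(i < j) lam ^+ i.
  have -> : j%:R * lam ^+ j = \sum_(i < j) lam ^+ j.
    by rewrite sumr_const card_ord mulr_natl.
  apply: ler_sum => l _; apply: ler_wiXn2l => //; first exact: ltW.
  exact: ltnW.
have L0 : 0 < lam ^+ j by rewrite exprn_gt0.
have jR0 : 0 < j%:R :> R by rewrite ltr0n.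
have D_ge : a * weight v * (j%:R * lam ^+ j) <= D.
  apply: le_trans Dlo; apply: ler_wpDl => //.
  by rewrite ler_pM2l.
have D0 : 0 < D by apply: lt_le_trans D_ge; rewrite !mulr_gt0.
have /andP[_] := bet i Bi; rewrite mxE => Dx.
rewrite -(ler_pM2l D0); apply: (le_trans Dx).
apply: (@le_trans _ _ (lam ^+ j * b * V)).
  by rewrite ler_pM2l ?mulr_gt0.
have KE : b * V = K * (a * weight v * e) by rewrite divfK // gt_eqF // mulr_gt0.
rewrite -mulrA KE; apply: (@le_trans _ _ (a * weight v * (j%:R * lam ^+ j) * e)); last first.
  by rewrite ler_pM2r.
have -> : a * weight v * (j%:R * lam ^+ j) * e = lam ^+ j * (j%:R * (a * weight v * e)) by ring.
by rewrite ler_pM2l // ler_pM2r // mulr_gt0.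
Qed.

Section Supercritical.
Variables (Q : pred 'I_n) (q : 'rV[R]_n) (l0 : 'I_n).
Hypothesis Q_closed : closed_block A phi Q.
Hypothesis q_cone : in_cone Q q.
Hypothesis Ql0 : Q l0.
Hypothesis A_l0 : forall i, Q i -> 0 < A l0 i.
Hypothesis q_weight : 0 < weight q.
Hypothesis q_eigen : q *m A = (1 + weight q) *: q.

Let lam := 1 + weight q.

Let lam_gt1 : 1 < lam. Proof. by rewrite /lam ltrDl. Qed.
Let lam_gt0 : 0 < lam. Proof. by apply: lt_trans lam_gt1. Qed.
Let q_gt0 i : Q i -> 0 < q 0 i. Proof. exact: (proj1 q_cone). Qed.
Let q_eig i : Q i -> (q *m A) 0 i = lam * q 0 i.
Proof. by move=> _; rewrite q_eigen mxE. Qed.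

Lemma proj_map_fixed : F q = q.
Proof. by rewrite /proj_map q_eigen scalerA mulVf ?scale1r // gt_eqF. Qed.

(** With [lam = 1 + weight q], the geometric sum in [iter_proj_map_bounds]
telescopes to [lam^j - 1]. *)
Lemma supercritical_bounds a b u j : nonneg u -> 0 < a -> between Q a b q u ->
  exists D, [/\ between Q (lam ^+ j * a) (lam ^+ j * b) q (D *: iter j F u),
    1 + (lam ^+ j - 1) * a <= D & D <= 1 + (lam ^+ j - 1) * b].
Proof.
move=> u0 a0 uq.
have [D [h1 h2 h3]] := iter_proj_map_bounds A_ge0 phi_ge0 Q_closed q_eig j u0 uq.
have geo : lam ^+ j - 1 = weight q * \sum_(i < j) lam ^+ i.
  by rewrite subrX1 /lam addrAC subrr add0r.
by exists D; split=> //; rewrite geo mulrC mulrA.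
Qed.

Lemma supercritical_stable a b u j : nonneg u -> 0 < a <= 1 -> 1 <= b ->
  between Q a b q u -> between Q (a / b) (b / a) q (iter j F u).
Proof.
move=> u0 /andP[a0 a1] b1 uq.
have [D [bet Dlo Dhi]] := supercritical_bounds j u0 a0 uq.
have b0 : 0 < b by lra.
have L1 : 1 <= lam ^+ j by rewrite exprn_ege1 // ltW.
have D0 : 0 < D by apply: lt_le_trans Dlo; rewrite ltr_pwDl // mulr_ge0 ?subr_ge0 // ltW.
move=> i Qi; have := bet i Qi; rewrite mxE => /andP[lo hi].
have qi := q_gt0 Qi.
apply/andP; split; rewrite -(ler_pM2l D0).
- apply: le_trans lo; rewrite mulrA ler_pM2r // mulrA ler_pdivrMr //.
  rewrite [D * a]mulrC [leRHS]mulrAC [leRHS]mulrC ler_pM2l //.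
  by apply: (le_trans Dhi); lra.
- apply: (le_trans hi); rewrite mulrA ler_pM2r // mulrA ler_pdivlMr //.
  rewrite mulrAC ler_pM2r //.
  by apply: le_trans Dlo; lra.
Qed.

(** First the ratios are made almost equal by the contraction; then, started from
there, [lam^j a / (1 + (lam^j - 1) b)] and the symmetric bound tend to [a / b]
and [b / a], which are close to 1. *)
Lemma supercritical_attract u e : nonneg u -> (forall i, Q i -> 0 < u 0 i) ->
  0 < e <= 1 -> exists J, forall j, (J <= j)%N ->
    between Q (1 - e) (1 + e) q (iter j F u).
Proof.
move=> u0 uQ /andP[e0 e1].
have [d [d0 d1 minor]] : exists d, [/\ 0 < d, d <= 1 &
    forall i, Q i -> d * (lam * q 0 i) <= q 0 l0 * A l0 i].
  have pos i : Q i -> 0 < (q 0 l0 * A l0 i) / (lam * q 0 i).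
    by move=> Qi; rewrite divr_gt0 // mulr_gt0 ?q_gt0 ?A_l0.
  have [d [d0 d1 Hd]] := finite_pos_lower_bound pos.
  exists d; split=> // i Qi; rewrite -ler_pdivlMr ?Hd // mulr_gt0 //; exact: q_gt0.
have [a [b [a0 a1 b1 uq]]] := exists_between q_gt0 uQ.
have rho0 : 0 <= (b - a) / a by apply: divr_ge0; [lra | exact: ltW].
have e2 : 0 < e / 2 / (1 + (b - a) / a) by rewrite !divr_gt0 //; lra.
have [||J1 HJ1] := @expr_small R (1 - d) (e / 2 / (1 + (b - a) / a)) => //.
  by apply/andP; split; lra.
have d01 : 0 < d <= 1 by rewrite d0.
have [a' [b' [a'0 gap bet]]] :=
  iter_ratio A_ge0 phi_ge0 Q_closed q_eig lam_gt0 q_gt0 Ql0 d01 minor J1 u0 a0 uq.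
(* Relative spread [e / 2]: half of the tolerance, the rest pays for finite [j]. *)
have {}gap : b' <= (1 + e / 2) * a'.
  have h : (1 - d) ^+ J1 * ((b - a) / a) <= e / 2.
    have := HJ1 J1 (leqnn _); rewrite ler_pdivlMr; last by lra.
    move=> h; apply: le_trans h; rewrite ler_wpM2l ?exprn_ge0 //; lra.
  have := ler_wpM2r (ltW a'0) h; move: gap; lra.
set x := iter J1 F u in bet.
have x0 : nonneg x by exact: iter_proj_map_nonneg.
(* The first summand is what the upper bound needs, the second the lower one. *)
have [J2 HJ2] := @expr_large R lam (2 * (1 + e) / e + 2 / (e * a')) lam_gt1.
exists (J1 + J2)%N => j Jj.
have Jj1 : (J1 <= j)%N by apply: leq_trans Jj; exact: leq_addr.
have L_ge : 2 * (1 + e) / e + 2 / (e * a') <= lam ^+ (j - J1).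
  by apply: HJ2; rewrite leq_subRL.
rewrite -(subnK Jj1) iterD -/x.
move: (j - J1)%N L_ge => r; set L := lam ^+ r => L_ge.
have [D [bet2 Dlo Dhi]] := supercritical_bounds r x0 a'0 bet.
rewrite -/L in bet2 Dlo Dhi.
have ea0 : 0 < e * a' by rewrite mulr_gt0.
have t1 : 0 < 2 / (e * a') by rewrite divr_gt0.
have t2 : 0 < 2 * (1 + e) / e by rewrite divr_gt0 //; lra.
have L1 : 2 * (1 + e) <= L * e by rewrite -ler_pdivrMr //; lra.
have L2 : 2 <= L * (e * a') by rewrite -ler_pdivrMr //; lra.
have Lgt : 1 <= L by rewrite exprn_ege1 // ltW.
have D0 : 0 < D by apply: lt_le_trans Dlo; rewrite ltr_pwDl // mulr_ge0 ?subr_ge0 // ltW.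
have lo : (1 - e) * D <= L * a'.
  apply: (@le_trans _ _ ((1 - e) * (1 + (L - 1) * ((1 + e / 2) * a')))).
    rewrite ler_wpM2l ?subr_ge0 //; apply: (le_trans Dhi).
    by rewrite lerD2l ler_wpM2l // subr_ge0.
  have La : 0 <= L * a' by rewrite mulr_ge0 // ltW //; lra.
  have ee : 0 <= e * e * (L * a') by rewrite mulr_ge0 // mulr_ge0 // ltW.
  have pa : 0 <= (1 - e) * (1 + e / 2) * a' by rewrite !mulr_ge0 //; lra.
  nra.
have hi : L * b' <= (1 + e) * D.
  apply: (@le_trans _ _ (L * ((1 + e / 2) * a'))).
    by rewrite ler_wpM2l //; lra.
  apply: (@le_trans _ _ ((1 + e) * (1 + (L - 1) * a'))); last first.
    by rewrite ler_wpM2l //; lra.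
  have := ler_wpM2r (ltW a'0) L1; nra.
move=> i Qi; have := bet2 i Qi; rewrite mxE => /andP[lo' hi'].
have qi := q_gt0 Qi.
apply/andP; split; rewrite -(ler_pM2l D0).
- by apply: le_trans lo'; rewrite mulrA ler_pM2r // mulrC.
- by apply: (le_trans hi'); rewrite mulrA ler_pM2r // [leRHS]mulrC.
Qed.

End Supercritical.

End Asymptotics.

Definition attracting_fixed_point (R : realType) n (Q : pred 'I_n)
    (F : 'rV[R]_n -> 'rV[R]_n) (q : 'rV[R]_n) : Prop :=
  [/\ in_cone Q q, F q = q,
     forall e, 0 < e -> exists2 d, 0 < d & forall u, in_cone Q u ->
       (forall i, `|u 0 i - q 0 i| <= d) ->
       forall j i, `|iter j F u 0 i - q 0 i| <= e &
     forall u e, in_cone Q u -> 0 < e -> exists J, forall j, (J <= j)%N ->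
       forall i, `|iter j F u 0 i - q 0 i| <= e].

Definition vanishing_on (R : realType) n (P Q : pred 'I_n)
    (F : 'rV[R]_n -> 'rV[R]_n) : Prop :=
  forall u e, in_cone Q u -> 0 < e -> exists J, forall j, (J <= j)%N ->
    forall i, P i -> iter j F u 0 i <= e.

Section Dichotomy.
Variables (R : realType) (n : nat) (A : 'M[R]_n) (phi : 'cV[R]_n).
Variables (P Q : pred 'I_n).
Hypothesis P_sub_Q : forall i, P i -> Q i.
Hypothesis P_nonempty : exists l, P l.
Hypothesis A_ge0 : forall l i, 0 <= A l i.
Hypothesis A_gt0 : forall l i, P l -> Q i -> 0 < A l i.
Hypothesis A_id : forall l i, Q l -> ~~ P l -> A l i = (l == i)%:R.
Hypothesis A_row0 : forall l i, ~~ Q l -> A l i = 0.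
Hypothesis A_col0 : forall l i, ~~ Q i -> A l i = 0.
Hypothesis phi_gt0 : forall l, P l -> 0 < phi l 0.
Hypothesis phi_eq0 : forall l, ~~ P l -> phi l 0 = 0.

Local Notation F := (proj_map A phi).

Let phi_ge0 l : 0 <= phi l 0.
Proof. by case: (boolP (P l)) => [/phi_gt0/ltW//|/phi_eq0 ->]. Qed.

Let P_closed : closed_block A phi P.
Proof.
split=> // l i nPl Pi; have [Ql|nQl] := boolP (Q l); last by rewrite A_row0.
by rewrite A_id //; case: eqP => // li; move: nPl; rewrite li Pi.
Qed.

Let Q_closed : closed_block A phi Q.
Proof.
split=> [l i nQl _|l nQl]; first by rewrite A_row0.
by rewrite phi_eq0 //; apply: contraNN nQl; exact: P_sub_Q.
Qed.

Lemma weight_pos u : nonneg u -> (forall i, P i -> 0 < u 0 i) -> 0 < weight phi u.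
Proof.
move=> u0 uP; have [l Pl] := P_nonempty; rewrite weightE (bigD1 l) //=.
rewrite ltr_pwDl ?mulr_gt0 ?uP ?phi_gt0 //; apply: sumr_ge0 => i _.
by rewrite mulr_ge0.
Qed.

(** Off [P] the matrix acts as the identity plus the inflow from [P], so the
eigenvalue equation there reads [(lam - 1) w_i = (v A)_i]. Rescaling then
adjusts the weight. *)
Lemma extend_eigenvector (lam : R) (v : 'rV[R]_n) :
  1 < lam -> in_cone P v -> (forall i, P i -> (v *m A) 0 i = lam * v 0 i) ->
  exists q, [/\ in_cone Q q, q *m A = lam *: q & 1 + weight phi q = lam].
Proof.
move=> lam1 [vP vN] eig.
have v_ge0 : nonneg v by apply: (@in_cone_nonneg _ _ P).
have lam10 : 0 < lam - 1 by lra.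
pose w : 'rV[R]_n := \row_i (if P i then v 0 i else (lam - 1)^-1 * (v *m A) 0 i).
have wP i : P i -> w 0 i = v 0 i by move=> Pi; rewrite mxE Pi.
have wN i : ~~ P i -> w 0 i = (lam - 1)^-1 * (v *m A) 0 i.
  by move=> /negbTE Pi; rewrite mxE Pi.
have vA_gt0 i : Q i -> 0 < (v *m A) 0 i.
  move=> Qi; have [l Pl] := P_nonempty.
  rewrite row_mulmxE (bigD1 l) //= ltr_pwDl ?mulr_gt0 ?vP ?A_gt0 //.
  by apply: sumr_ge0 => k _; rewrite mulr_ge0.
have w_cone : in_cone Q w.
  split=> i Qi.
    have [/[dup] Pi /wP ->|/wN ->] := boolP (P i); first exact: vP.
    by rewrite mulr_gt0 ?invr_gt0 ?vA_gt0.
  have nPi : ~~ P i by apply: contraNN Qi; exact: P_sub_Q.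
  rewrite wN // row_mulmxE big1 ?mulr0 // => l _.
  by rewrite A_col0 // mulr0.
have w_eig : w *m A = lam *: w.
  apply/rowP => i; rewrite [RHS]mxE.
  have -> : (w *m A) 0 i = (v *m A) 0 i + (if P i then 0 else w 0 i).
    rewrite !row_mulmxE.
    have -> : \sum_l w 0 l * A l i =
        \sum_l (v 0 l * A l i + (l == i)%:R * (if P l then 0 else w 0 l)).
      apply: eq_bigr => l _; have [Pl|nPl] := boolP (P l).
        by rewrite wP // mulr0 addr0.
      rewrite vN // mul0r add0r; have [Ql|nQl] := boolP (Q l); first by rewrite A_id // mulrC.
      by rewrite (proj2 w_cone) // mul0r mulr0.
    rewrite big_split /=; congr (_ + _).
    by rewrite (bigD1 i) //= eqxx mul1r big1 ?addr0 // => l /negbTE ->; rewrite mul0r.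
  have [Pi|nPi] := boolP (P i); first by rewrite addr0 eig // wP.
  have -> : (v *m A) 0 i = (lam - 1) * w 0 i by rewrite wN // mulVKf // gt_eqF.
  ring.
have w_weight : 0 < weight phi w.
  apply: weight_pos; first exact: in_cone_nonneg w_cone.
  by move=> i /P_sub_Q; exact: (proj1 w_cone).
pose c := (lam - 1) / weight phi w.
have c0 : 0 < c by rewrite divr_gt0.
exists (c *: w); split.
- split=> i Qi; rewrite mxE; first by rewrite mulr_gt0 // (proj1 w_cone).
  by rewrite (proj2 w_cone) // mulr0.
- by rewrite -scalemxAl w_eig !scalerA mulrC.
- by rewrite weightZ divfK ?gt_eqF // addrC subrK.
Qed.

Lemma iter_proj_map_off u j i : in_cone Q u -> ~~ Q i -> iter j F u 0 i = 0.
Proof.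
move=> [_ uN] nQi; case: j => [|j]; first exact: uN.
rewrite iterS /proj_map mxE row_mulmxE big1 ?mulr0 // => l _.
by rewrite A_col0 // mulr0.
Qed.

Theorem proj_map_dichotomy :
  (exists q, attracting_fixed_point Q F q) \/ vanishing_on P Q F.
Proof.
have [lam [v [lam0 vP vN eig]]] := perron P_nonempty (fun l i Pl Pi => A_gt0 Pl (P_sub_Q Pi)).
have [lam1|lam1] := leP lam 1.
  right=> u e uQ e0; have u0 := in_cone_nonneg uQ.
  apply: (subcritical_vanish A_ge0 phi_ge0 P_closed eig _ vP) => //.
  - by rewrite lam0.
  - by apply: weight_pos => //; apply: (@in_cone_nonneg _ _ P).
  - by move=> i /P_sub_Q; exact: (proj1 uQ).
left.
have [|q [q_cone q_eig q_w]] := extend_eigenvector lam1 _ eig; first by split.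
have [l0 Pl0] := P_nonempty.
have Ql0 := P_sub_Q Pl0.
have q_weight : 0 < weight phi q by lra.
have {}q_eig : q *m A = (1 + weight phi q) *: q by rewrite q_w.
have [qM [qM1 HqM]] := @finite_upper_bound R _ (fun i => q 0 i).
have qM0 : 0 < qM by lra.
have dist_of (x : 'rV[R]_n) e : 0 <= e -> (forall i, ~~ Q i -> x 0 i = 0) ->
    between Q (1 - e) (1 + e) q x -> forall i, `|x 0 i - q 0 i| <= e * qM.
  move=> e0 xN bet i; have [Qi|nQi] := boolP (Q i); last first.
    by rewrite xN // (proj2 q_cone) // subr0 normr0 mulr_ge0 // ltW.
  have /andP[h1 h2] := bet i Qi; apply: (@le_trans _ _ (e * q 0 i)).
    by rewrite ler_norml; apply/andP; split; lra.
  by rewrite ler_wpM2l.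
exists q; split=> //; first exact: proj_map_fixed.
- move=> e e0.
  pose h := Num.min (1 / 2) (e / (4 * qM)).
  have h0 : 0 < h by rewrite lt_min !divr_gt0 // mulr_gt0.
  have h_half : h <= 1 / 2 by rewrite ge_min lexx.
  have h_e : 4 * h * qM <= e.
    have : h <= e / (4 * qM) by rewrite ge_min lexx orbT.
    by rewrite ler_pdivlMr ?mulr_gt0 //; lra.
  have [m [m0 _ Hm]] := finite_pos_lower_bound (proj1 q_cone).
  exists (h * m) => [|u u_cone close j]; first by rewrite mulr_gt0.
  have u0 := in_cone_nonneg u_cone.
  have bet : between Q (1 - h) (1 + h) q u.
    move=> i Qi; have := close i; rewrite ler_norml => /andP[h1 h2].
    have : h * m <= h * q 0 i by rewrite ler_pM2l // Hm.
    by move=> h3; apply/andP; split; lra.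
  have h01 : 0 < 1 - h <= 1 by apply/andP; split; lra.
  have h1 : 1 <= 1 + h by lra.
  have bet2 := supercritical_stable A_ge0 phi_ge0 Q_closed q_cone q_weight q_eig j u0 h01 h1 bet.
  move=> i; apply: le_trans h_e; move: i; apply: dist_of; first by lra.
    by move=> i; exact: iter_proj_map_off.
  move=> i Qi; have /andP[b1 b2] := bet2 i Qi; have qi := proj1 q_cone i Qi.
  apply/andP; split.
    apply: le_trans b1; rewrite ler_pM2r // ler_pdivlMr; last by lra.
    nra.
  apply: (le_trans b2); rewrite ler_pM2r // ler_pdivrMr; last by lra.
  nra.
- move=> u e u_cone e0.
  pose h := Num.min 1 (e / qM).
  have h0 : 0 < h by rewrite lt_min ltr01 divr_gt0.
  have h1 : h <= 1 by rewrite ge_min lexx.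
  have h_e : h * qM <= e by rewrite -ler_pdivlMr // ge_min lexx orbT.
  have h01 : 0 < h <= 1 by rewrite h0.
  have [J HJ] := supercritical_attract A_ge0 phi_ge0 Q_closed q_cone Ql0
    (fun i => A_gt0 Pl0) q_weight q_eig (in_cone_nonneg u_cone) (proj1 u_cone) h01.
  exists J => j /HJ bet i; apply: le_trans h_e; move: i.
  apply: dist_of => //; first exact: ltW.
  by move=> i; exact: iter_proj_map_off.
Qed.

End Dichotomy.

(** * Crossing one region *)

Section Signs.
Variable R : realType.

(** Multiplying a coordinate by its sign turns sign conditions into inequalities
that the ring and order tactics can use. *)
Definition sgb (b : bool) : R := if b then 1 else -1.

Lemma has_signE b (a : R) : has_sign b a <-> 0 < sgb b * a.
Proof. by case: b; rewrite /= ?mul1r ?mulN1r ?oppr_gt0. Qed.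

Lemma sgb_negb b : sgb (~~ b) = - sgb b.
Proof. by case: b; rewrite /= ?opprK. Qed.

Lemma sgbK b : sgb b * sgb b = 1.
Proof. by case: b; rewrite /= ?mulrNN mulr1. Qed.

Lemma sgb_neq0 b : sgb b != 0.
Proof. by case: b; rewrite /= ?oppr_eq0 oner_eq0. Qed.

Lemma normr_sgb b (a : R) : 0 <= sgb b * a -> `|a| = sgb b * a.
Proof.
case: b; rewrite /= ?mul1r ?mulN1r; first exact: ger0_norm.
by rewrite oppr_ge0; exact: ler0_norm.
Qed.

Lemma normr_sgbM b (a : R) : `|sgb b * a| = `|a|.
Proof. by case: b; rewrite /= ?mul1r ?mulN1r ?normrN. Qed.

Lemma has_sign_distr b (a c : R) : has_sign b a -> has_sign b c ->
  `|a - c| = `| `|a| - `|c| |.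
Proof.
move=> /has_signE /ltW/normr_sgb -> /has_signE /ltW/normr_sgb ->.
by rewrite -mulrBr normr_sgbM.
Qed.

Lemma has_sign_neq0 b (a : R) : has_sign b a -> a != 0.
Proof. by case: b => /=; [move/gt_eqF -> | move/lt_eqF ->]. Qed.

Lemma has_sign_inj b b' (a : R) : has_sign b a -> has_sign b' a -> b = b'.
Proof. by case: b b' => -[] //= h1 h2; have := lt_trans h1 h2; rewrite ltxx. Qed.

End Signs.

Definition absv (R : realType) n (x : 'rV[R]_n) : 'rV[R]_n := \row_j `|x 0 j|.

Lemma absvE (R : realType) n (x : 'rV[R]_n) j : absv x 0 j = `|x 0 j|.
Proof. by rewrite mxE. Qed.

Section Crossing.
Variables (R : realType) (n k : nat) (N : glass_network R n) (C : region_cycle n k).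
Hypothesis hC : cyclic_attractor N C.

Local Notation f := (cycle_focal N C).
Local Notation sg i j := (@sgb R (region C i j)).

Lemma flowE (g x : 'rV[R]_n) t j :
  flow g x t 0 j = g 0 j + expR (- t) * (x 0 j - g 0 j).
Proof. by rewrite /flow !mxE. Qed.

Lemma focal_coord_neq0 i j : f i 0 j != 0.
Proof. exact: focal_neq0. Qed.

Lemma focal_norm_gt0 i j : 0 < `|f i 0 j|.
Proof. by rewrite normr_gt0 focal_coord_neq0. Qed.

Lemma region_succ i j : j != switch C i -> region C (ordS i) j = region C i j.
Proof.
move=> /negbTE jm; have := cycle_adjacent (proj1 hC) i j; rewrite jm.
by move=> /negbFE /eqP.
Qed.

Lemma region_flip i :
  region C (ordS i) (switch C i) = ~~ region C i (switch C i).
Proof.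
have := cycle_adjacent (proj1 hC) i (switch C i); rewrite eqxx.
by case: (region C (ordS i) _); case: (region C i _).
Qed.

Lemma switch_succ_neq i : switch C (ordS i) != switch C i.
Proof.
apply/negP => /eqP e.
have := cycle_enter (proj1 hC) i; have := cycle_exit (proj1 hC) (ordS i).
have := region_flip (ordS i); rewrite e => flip h1 h2.
by have := has_sign_inj h1 h2; rewrite flip; case: (region C (ordS i) _).
Qed.

(** Otherwise some coordinate [j], besides the switching one [m], has its focal
value on the other side of 0. Starting from [|x_l| = |f_l|] for all [l], the
coordinates [j] and [m] vanish at the same time, so the trajectory does not
leave through the relatively open wall. *)
Lemma focal_sign i j : has_sign (region C (ordS i) j) (f i 0 j).
Proof.
have [->|jm] := eqVneq j (switch C i); first exact: cycle_exit (proj1 hC) i.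
rewrite region_succ //.
pose x : 'rV[R]_n := \row_l (sg i l * `|f i 0 l|).
have x_in : cycle_orthant C i x.
  by move=> l; apply/has_signE; rewrite mxE mulrA sgbK mul1r focal_norm_gt0.
have [t t0 [_ [fm fl]]] := proj2 hC i x x_in.
have {fl} := fl j jm; move: fm; rewrite !flowE !mxE => fm /has_signE fj.
apply/has_signE; rewrite ltNge; apply/negP => neg.
have nj : `|f i 0 j| = - (sg i j * f i 0 j).
  by rewrite -(normr_sgbM (region C i j)) ler0_norm.
have nm : `|f i 0 (switch C i)| = - (sg i (switch C i) * f i 0 (switch C i)).
  have := cycle_exit (proj1 hC) i; rewrite region_flip => /has_signE /ltW.
  by move=> /normr_sgb; rewrite sgb_negb mulNr.
have fn := focal_coord_neq0 i (switch C i).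
(* The coordinate [m] starts at distance [2 |f_m|] from its focal value and
   exits at distance [|f_m|]. *)
have e2 : expR (- t) = 1 / 2.
  move: fm; rewrite nm mulrN mulrA sgbK mul1r => fm.
  have : f i 0 (switch C i) * (1 - 2 * expR (- t)) = 0 by rewrite -[RHS]fm; ring.
  move=> /eqP; rewrite mulf_eq0 (negbTE fn) /= => /eqP; lra.
move: fj; rewrite nj mulrN mulrA sgbK mul1r e2.
have -> : f i 0 j + 1 / 2 * (- f i 0 j - f i 0 j) = 0 by field.
by rewrite mulr0 ltxx.
Qed.

Lemma signed_focal i j :
  sg i j * f i 0 j = if j == switch C i then - `|f i 0 j| else `|f i 0 j|.
Proof.
have /has_signE /ltW /normr_sgb -> := focal_sign i j.
have [->|jm] := eqVneq j (switch C i); last by rewrite region_succ.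
by rewrite region_flip sgb_negb mulNr opprK.
Qed.

(** A condition common to the region and to the wall through which it
is entered, which suffices for the crossing formulas. *)
Definition ready i (x : 'rV[R]_n) :=
  (forall j, 0 <= sg i j * x 0 j) /\ 0 < sg i (switch C i) * x 0 (switch C i).

Lemma ready_orthant i x : cycle_orthant C i x -> ready i x.
Proof.
by move=> xi; split=> [j|]; [apply/ltW|]; apply/has_signE; exact: xi.
Qed.

Lemma ready_wall i x : cycle_wall C i x -> ready (ordS i) x.
Proof.
move=> [x0 xj]; split=> [j|]; last first.
  apply/has_signE; rewrite region_succ ?xj // ?switch_succ_neq //.
  by apply: xj; exact: switch_succ_neq.
have [->|jm] := eqVneq j (switch C i); first by rewrite x0 mulr0.
by rewrite region_succ //; apply/ltW/has_signE; exact: xj.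
Qed.

Lemma ready_norm i x j : ready i x -> `|x 0 j| = sg i j * x 0 j.
Proof. by case=> h _; apply: normr_sgb. Qed.

Lemma ready_switch_gt0 i x : ready i x -> 0 < `|x 0 (switch C i)|.
Proof. by move=> rx; rewrite (ready_norm _ rx); case: rx. Qed.

Lemma signed_flow i x t j : ready i x ->
  sg i j * flow (f i) x t 0 j =
    if j == switch C i then expR (- t) * (`|x 0 j| + `|f i 0 j|) - `|f i 0 j|
    else expR (- t) * `|x 0 j| + (1 - expR (- t)) * `|f i 0 j|.
Proof.
move=> rx; rewrite flowE (ready_norm _ rx) mulrDr mulrCA mulrBr signed_focal.
by case: eqP => _; ring.
Qed.

Definition exit_time i (x : 'rV[R]_n) : R :=
  ln (1 + `|x 0 (switch C i)| / `|f i 0 (switch C i)|).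

Definition exit_point i x := flow (f i) x (exit_time i x).

Lemma exit_ratio_ge0 i (x : 'rV[R]_n) : 0 <= `|x 0 (switch C i)| / `|f i 0 (switch C i)|.
Proof. by rewrite divr_ge0. Qed.

Lemma exp_exit_time i (x : 'rV[R]_n) :
  expR (- exit_time i x) = (1 + `|x 0 (switch C i)| / `|f i 0 (switch C i)|)^-1.
Proof. by rewrite expRN lnK // posrE; have := exit_ratio_ge0 i x; lra. Qed.

Lemma exit_time_gt0 i x : ready i x -> 0 < exit_time i x.
Proof.
move=> rx; apply: ln_gt0; rewrite ltrDl divr_gt0 ?focal_norm_gt0 //.
exact: ready_switch_gt0.
Qed.

Lemma signed_flow_switch i x t : ready i x ->
  sg i (switch C i) * flow (f i) x t 0 (switch C i) =
  (expR (- t) - expR (- exit_time i x)) * (`|x 0 (switch C i)| + `|f i 0 (switch C i)|).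
Proof.
move=> rx; rewrite signed_flow // eqxx exp_exit_time mulrBl; congr (_ - _).
have f0 := focal_norm_gt0 i (switch C i); have x0 := ready_switch_gt0 rx.
by field; apply/andP; split; rewrite gt_eqF //; lra.
Qed.

Lemma flow_in_orthant i x t : ready i x -> 0 < t < exit_time i x ->
  cycle_orthant C i (flow (f i) x t).
Proof.
move=> rx /andP[t0 tT] j; apply/has_signE.
have f0 := focal_norm_gt0 i j.
have [->|jm] := eqVneq j (switch C i).
  rewrite signed_flow_switch // mulr_gt0 //; first by rewrite subr_gt0 ltr_expR ltrN2.
  by rewrite ltr_wpDl // focal_norm_gt0.
rewrite signed_flow // (negbTE jm); apply: ltr_wpDl.
  by rewrite mulr_ge0 // expR_ge0.
by rewrite mulr_gt0 // subr_gt0 -[X in _ < X]expR0 ltr_expR oppr_lt0.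
Qed.

Lemma exit_point_wall i x : ready i x -> cycle_wall C i (exit_point i x).
Proof.
move=> rx; split=> [|j jm].
  have := signed_flow_switch (exit_time i x) rx; rewrite subrr mul0r.
  by move=> /eqP; rewrite mulf_eq0 (negbTE (sgb_neq0 _ _)) => /eqP.
apply/has_signE; rewrite signed_flow // (negbTE jm); apply: ltr_wpDl.
  by rewrite mulr_ge0 // expR_ge0.
rewrite mulr_gt0 ?focal_norm_gt0 // subr_gt0 -[X in _ < X]expR0 ltr_expR oppr_lt0.
exact: exit_time_gt0.
Qed.

Lemma exit_time_unique i x t : ready i x ->
  flow (f i) x t 0 (switch C i) = 0 -> t = exit_time i x.
Proof.
move=> rx f0; have := signed_flow_switch t rx; rewrite f0 mulr0.
have p : 0 < `|x 0 (switch C i)| + `|f i 0 (switch C i)|.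
  by rewrite ltr_wpDl // focal_norm_gt0.
move=> /esym /eqP; rewrite mulf_eq0 (gt_eqF p) orbF subr_eq0 => /eqP /expR_inj.
exact: oppr_inj.
Qed.

Lemma ready_exit_point i x : ready i x -> ready (ordS i) (exit_point i x).
Proof. by move=> rx; apply: ready_wall; exact: exit_point_wall. Qed.

(** The numerator and the denominator of a crossing in absolute coordinates: at
the exit, [exp (- t) = F / (u_m + F)] with [F = |f_m|], and the coordinate [j]
becomes [(u_j F + u_m |f_j|) / (u_m + F)]. *)
Definition step_mx i : 'M[R]_n := \matrix_(l, j)
  if j == switch C i then 0
  else (l == j)%:R + (l == switch C i)%:R * (`|f i 0 j| / `|f i 0 (switch C i)|).

Definition step_cv i : 'cV[R]_n :=
  \col_l ((l == switch C i)%:R / `|f i 0 (switch C i)|).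

Lemma step_mxE i (u : 'rV[R]_n) j : (u *m step_mx i) 0 j =
  if j == switch C i then 0
  else u 0 j + u 0 (switch C i) * (`|f i 0 j| / `|f i 0 (switch C i)|).
Proof.
rewrite mxE; under eq_bigr do rewrite mxE; case: eqP => [_|jm].
  by rewrite big1 // => l _; rewrite mulr0.
under eq_bigr do rewrite mulrDr; rewrite big_split /=; congr (_ + _).
  by rewrite (bigD1 j) //= eqxx mulr1 big1 ?addr0 // => l /negbTE ->; rewrite mulr0.
rewrite (bigD1 (switch C i)) //= eqxx mul1r big1 ?addr0 // => l /negbTE ->.
by rewrite mul0r mulr0.
Qed.

Lemma step_cvE i (u : 'rV[R]_n) :
  weight (step_cv i) u = u 0 (switch C i) / `|f i 0 (switch C i)|.
Proof.
rewrite /weight mxE (bigD1 (switch C i)) //= mxE eqxx mul1r big1 ?addr0 // => l.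
by rewrite mxE => /negbTE ->; rewrite mul0r mulr0.
Qed.

Lemma absv_exit_point i x : ready i x ->
  absv (exit_point i x) = proj_map (step_mx i) (step_cv i) (absv x).
Proof.
move=> rx; apply/rowP => j; rewrite absvE proj_mapE step_mxE step_cvE !absvE.
have rx' := exit_point_wall rx.
have [->|jm] := eqVneq j (switch C i); first by rewrite (proj1 rx') normr0 mulr0.
have : has_sign (region C i j) (exit_point i x 0 j) by exact: (proj2 rx').
move=> /has_signE/ltW/normr_sgb ->; rewrite signed_flow // (negbTE jm) exp_exit_time.
have f0 := focal_norm_gt0 i (switch C i); have x0 := ready_switch_gt0 rx.
by field; apply/andP; split; rewrite gt_eqF //; lra.
Qed.

(** The fraction [1 - exp (- t)] of the way to the focal point never exceeds
[|x_m| / |f_m|], since the exit time bounds [t]. *)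
Lemma flow_coord_bound i x t j : ready i x -> 0 <= t <= exit_time i x ->
  `|flow (f i) x t 0 j| <=
    `|x 0 j| + `|x 0 (switch C i)| * (`|f i 0 j| / `|f i 0 (switch C i)|).
Proof.
move=> rx /andP[t0 tT].
have f0 := focal_norm_gt0 i (switch C i); have x0 := ready_switch_gt0 rx.
set r := `|x 0 (switch C i)| / `|f i 0 (switch C i)|.
have r0 : 0 < r by rewrite divr_gt0.
have -> : `|x 0 (switch C i)| * (`|f i 0 j| / `|f i 0 (switch C i)|) = r * `|f i 0 j|.
  by rewrite /r mulrCA mulrC.
have e1 : expR (- t) <= 1 by rewrite -[leRHS]expR0 ler_expR oppr_le0.
have e0 : 1 - expR (- t) <= r.
  have : expR (- exit_time i x) <= expR (- t) by rewrite ler_expR lerN2.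
  rewrite exp_exit_time -/r => h.
  have : 1 - (1 + r)^-1 <= r.
    have -> : 1 - (1 + r)^-1 = r * (1 + r)^-1 by field; rewrite gt_eqF //; lra.
    by rewrite ger_pMr // invf_le1; lra.
  lra.
have ep := expR_ge0 (- t).
rewrite flowE.
have -> : f i 0 j + expR (- t) * (x 0 j - f i 0 j) =
  expR (- t) * x 0 j + (1 - expR (- t)) * f i 0 j by ring.
apply: (le_trans (ler_normD _ _)); rewrite !normrM (ger0_norm ep).
rewrite (@ger0_norm _ (1 - expR (- t))); last by lra.
by apply: lerD; [rewrite ler_piMl | rewrite ler_wpM2r].
Qed.

End Crossing.

(** * Trajectories as sequences of crossings *)

Section CyclicIndex.
Variable k : nat.
Implicit Types i : 'I_k.+1.

Lemma val_iter_ordS i j : iter j (@ordS _) i = ((i + j) %% k.+1)%N :> nat.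
Proof.
elim: j => [|j IH]; first by rewrite addn0 modn_small.
by rewrite iterS /= IH -addn1 modnDml addn1 addnS.
Qed.

Lemma iter_ordS_period i : iter k.+1 (@ordS _) i = i.
Proof. by apply: ord_inj; rewrite val_iter_ordS modnDr modn_small. Qed.

Lemma iter_ordS_periodM i r : iter (r * k.+1) (@ordS _) i = i.
Proof. by apply: ord_inj; rewrite val_iter_ordS addnC modnMDl modn_small. Qed.

Lemma iter_ordS_reach i i' : exists2 j, (j < k.+1)%N & iter j (@ordS _) i = i'.
Proof.
exists ((i' + (k.+1 - i)) %% k.+1)%N; first by rewrite ltn_mod.
apply: ord_inj; rewrite val_iter_ordS modnDmr addnCA subnKC; last exact: ltnW.
by rewrite modnDr modn_small.
Qed.

Lemma iter_ordS_fixed i j : iter j (@ordS _) i = i -> (k.+1 %| j)%N.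
Proof.
move=> /(congr1 (@nat_of_ord _)); rewrite val_iter_ordS => h.
have : (i + j = i + 0 %[mod k.+1])%N by rewrite h addn0 modn_small.
by move=> /eqP; rewrite eqn_modDl mod0n.
Qed.

End CyclicIndex.

Section Trajectories.
Variables (R : realType) (n k : nat) (N : glass_network R n) (C : region_cycle n k).
Hypothesis hC : cyclic_attractor N C.

Local Notation f := (cycle_focal N C).
Local Notation rot j i := (iter j (@ordS k.+1) i).
Local Notation i0 := (ordS (@ord0 k)).

Fixpoint orbit_pt i (x : 'rV[R]_n) j : 'rV[R]_n :=
  if j is j'.+1 then exit_point N C (rot j' i) (orbit_pt i x j') else x.

Fixpoint orbit_time i (x : 'rV[R]_n) j : R :=
  if j is j'.+1 then orbit_time i x j' + exit_time N C (rot j' i) (orbit_pt i x j')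
  else 0.

Definition entering i (x : 'rV[R]_n) :=
  cycle_orthant C i x \/ cycle_wall C (ord_pred i) x.

Lemma ready_entering i x : entering i x -> ready C i x.
Proof.
case=> [|/(ready_wall hC)]; first exact: ready_orthant.
by rewrite ord_predK.
Qed.

Lemma entering_wall0 x : wall0 C x -> entering i0 x.
Proof. by right; rewrite ordSK. Qed.

Lemma ready_orbit_pt i x j : ready C i x -> ready C (rot j i) (orbit_pt i x j).
Proof. by move=> rx; elim: j => // j IH; exact: (ready_exit_point hC IH). Qed.

Lemma orbit_pt_add i x a b :
  orbit_pt i x (a + b) = orbit_pt (rot a i) (orbit_pt i x a) b.
Proof. by elim: b => [|b IH]; rewrite ?addn0 // addnS /= IH -iterD addnC. Qed.

Lemma orbit_time_add i x a b : orbit_time i x (a + b) =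
  orbit_time i x a + orbit_time (rot a i) (orbit_pt i x a) b.
Proof.
elim: b => [|b IH]; first by rewrite addn0 addr0.
by rewrite addnS /= IH orbit_pt_add -iterD addnC addrA.
Qed.

Lemma orbit_time_lt i x j : ready C i x -> orbit_time i x j < orbit_time i x j.+1.
Proof. by move=> rx; rewrite /= ltrDl; apply: exit_time_gt0; exact: ready_orbit_pt. Qed.

Lemma increasing_homo (t : nat -> R) : (forall j, t j < t j.+1) ->
  {homo t : a b / (a <= b)%N >-> a <= b}.
Proof.
move=> tS a b /subnK <-; elim: (b - a)%N => // c IH.
by rewrite addSn (le_trans IH) // ltW.
Qed.

Lemma switching_interval (t : nat -> R) s J : t 0%N <= s < t J ->
  exists2 j, (j < J)%N & t j <= s < t j.+1.
Proof.
elim: J => [|J IH] /andP[s0 sJ]; first by have := le_lt_trans s0 sJ; rewrite ltxx.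
have [lt|ge] := ltP s (t J); last by exists J => //; rewrite ge.
by have [|j jJ h] := IH; [rewrite s0|exists j => //; exact: ltnW].
Qed.

Lemma switching_interval_unique (t : nat -> R) s a b : (forall j, t j < t j.+1) ->
  t a <= s < t a.+1 -> t b <= s < t b.+1 -> a = b.
Proof.
move=> tS; wlog ab : a b / (a < b)%N => [W ha hb|].
  by case: (ltngtP a b) => // h; [exact: W | apply/esym; exact: W].
move=> /andP[_ sa] /andP[bs _].
have := lt_le_trans sa (le_trans (increasing_homo tS ab) bs); by rewrite ltxx.
Qed.

Lemma end_timeP (t : nat -> R) s : (s%:E < end_time t)%E <-> exists j, s < t j.
Proof.
split=> [/ereal_sup_gt[_ [j _ <-]]|[j sj]]; first by rewrite lte_fin => h; exists j.
by apply: (@lt_le_trans _ _ (t j)%:E); [rewrite lte_fin | apply: ereal_sup_ubound; exists j].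
Qed.

Lemma flow0 (g x : 'rV[R]_n) : flow g x 0 = x.
Proof. by rewrite /flow oppr0 expR0 scale1r addrC subrK. Qed.

Lemma trajectory_orbit i t y : trajectory N C i t y ->
  forall j, y (t j) = orbit_pt i (y 0) j /\ t j = orbit_time i (y 0) j.
Proof.
move=> tr; have rx : ready C i (y 0) by apply: ready_entering; exact: traj_start tr.
elim=> [|j [IHy IHt]]; first by rewrite (traj_time0 tr).
have tj := traj_time_lt tr j.
have fl : y (t j.+1) = flow (f (rot j i)) (orbit_pt i (y 0) j) (t j.+1 - t j).
  by rewrite -IHy; apply: (traj_flow tr); rewrite lexx ltW.
have e : t j.+1 - t j = exit_time N C (rot j i) (orbit_pt i (y 0) j).
  apply: (exit_time_unique hC); first exact: ready_orbit_pt.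
  by rewrite -fl; case: (traj_wall tr j).
by rewrite /= /exit_point -e -fl -IHt addrC subrK.
Qed.

Lemma trajectory_unique i t y t' y' : trajectory N C i t y -> trajectory N C i t' y' ->
  y 0 = y' 0 -> t =1 t' /\ forall s, 0 <= s -> (s%:E < end_time t)%E -> y s = y' s.
Proof.
move=> tr tr' e.
have tt j : t j = t' j.
  by rewrite (proj2 (trajectory_orbit tr j)) (proj2 (trajectory_orbit tr' j)) e.
split=> // s s0 /end_timeP[J sJ].
have [|j _ /andP[h1 h2]] := @switching_interval t s J; first by rewrite (traj_time0 tr) s0.
rewrite (traj_flow tr (j := j)) ?h1 ?ltW // (traj_flow tr' (j := j)) -?tt ?h1 ?ltW //.
by rewrite (proj1 (trajectory_orbit tr j)) {2}tt (proj1 (trajectory_orbit tr' j)) e.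
Qed.

Lemma trajectory_shift i t y a : trajectory N C i t y ->
  trajectory N C (rot a.+1 i) (fun j => t (a.+1 + j)%N - t a.+1) (fun s => y (s + t a.+1)).
Proof.
move=> tr; split.
- by right; rewrite add0r iterS ordSK; exact: traj_wall tr a.
- by rewrite addn0 subrr.
- by move=> j; rewrite ltrD2r addnS; exact: (traj_time_lt tr).
- move=> j s /andP[h1 h2]; rewrite -iterD (addnC j) subrK.
  rewrite (traj_flow tr (j := (a.+1 + j)%N)); first by congr flow; ring.
  by rewrite -lerBlDr h1 -lerBrDr -addnS.
- move=> j s /andP[h1 h2]; rewrite -iterD (addnC j); apply: (traj_region tr).
  by rewrite -ltrBlDr h1 -ltrBrDr -addnS.
- by move=> j; rewrite -iterD (addnC j) addnS subrK; exact: (traj_wall tr).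
Qed.

Lemma end_time_shift (t : nat -> R) a s : (forall j, t j < t j.+1) ->
  (s%:E < end_time t)%E <->
  ((s - t a)%:E < end_time (fun j => (t (a + j)%N - t a)%R))%E.
Proof.
move=> tS; rewrite !end_timeP; split=> -[j h].
  exists j; rewrite ltrD2r; apply: (lt_le_trans h).
  by apply: increasing_homo => //; exact: leq_addl.
by exists (a + j)%N; move: h; rewrite ltrD2r.
Qed.

(** The interval of switching times that contains [s] is unique, so the arbitrary
choice made by [xget] is harmless; past the end time the value is immaterial. *)
Definition orbit_curve i (x : 'rV[R]_n) (s : R) : 'rV[R]_n :=
  let j := xget 0%N [set j | orbit_time i x j <= s < orbit_time i x j.+1] in
  flow (f (rot j i)) (orbit_pt i x j) (s - orbit_time i x j).

Lemma orbit_curveE i x j s : ready C i x ->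
  orbit_time i x j <= s <= orbit_time i x j.+1 ->
  orbit_curve i x s = flow (f (rot j i)) (orbit_pt i x j) (s - orbit_time i x j).
Proof.
move=> rx; have tS l := orbit_time_lt l rx.
have main a : orbit_time i x a <= s < orbit_time i x a.+1 ->
    orbit_curve i x s = flow (f (rot a i)) (orbit_pt i x a) (s - orbit_time i x a).
  move=> h; rewrite /orbit_curve (xget_unique 0%N (x := a)) //.
  by move=> b hb; apply: switching_interval_unique hb h.
move=> /andP[h1]; rewrite le_eqVlt => /orP[/eqP e|h2]; last by apply: main; rewrite h1.
rewrite (main j.+1) e; last by rewrite lexx tS.
by rewrite subrr flow0 /= /exit_point addrAC subrr add0r.
Qed.

Lemma orbit_curve_time i x j : ready C i x ->
  orbit_curve i x (orbit_time i x j) = orbit_pt i x j.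
Proof.
move=> rx; rewrite (orbit_curveE (j := j) rx) ?subrr ?flow0 //.
by rewrite lexx ltW // orbit_time_lt.
Qed.

Lemma orbit_curve0 i x : ready C i x -> orbit_curve i x 0 = x.
Proof. exact: (@orbit_curve_time i x 0%N). Qed.

Lemma orbit_trajectory i x : entering i x ->
  trajectory N C i (orbit_time i x) (orbit_curve i x).
Proof.
move=> ex; have rx := ready_entering ex; split.
- by rewrite orbit_curve0.
- by [].
- by move=> j; exact: orbit_time_lt.
- by move=> j s h; rewrite orbit_curve_time // (orbit_curveE rx h).
- move=> j s /andP[h1 h2]; rewrite (orbit_curveE (j := j) rx) ?ltW //.
  apply: (flow_in_orthant hC); first exact: ready_orbit_pt.
  by rewrite subr_gt0 h1 ltrBlDl.
- move=> j; rewrite orbit_curve_time //; apply: (exit_point_wall hC).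
  exact: ready_orbit_pt.
Qed.

End Trajectories.

(** * The return map *)

Section ReturnMap.
Variables (R : realType) (n k : nat) (N : glass_network R n) (C : region_cycle n k).
Hypothesis hC : cyclic_attractor N C.

Local Notation f := (cycle_focal N C).
Local Notation rot j i := (iter j (@ordS k.+1) i).
Local Notation i0 := (ordS (@ord0 k)).
Local Notation m0 := (switch C ord0).
Local Notation sw j := (switch C (rot j i0)).
Local Notation ret := (return_map N C).

(** [chain_mx j] and [chain_cv j] describe [j] crossings from the wall 0. The
initial projection kills the coordinate that vanishes on the wall 0; the vectors
of interest do not change, and its row becomes 0. *)
Fixpoint chain_mx j : 'M[R]_n :=
  if j is j'.+1 then chain_mx j' *m step_mx N C (rot j' i0)
  else \matrix_(l, i) ((l == i) && (l != m0))%:R.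

Fixpoint chain_cv j : 'cV[R]_n :=
  if j is j'.+1 then chain_cv j' + chain_mx j' *m step_cv N C (rot j' i0)
  else 0.

Lemma ratio_gt0 j i : 0 < `|f (rot j i0) 0 i| / `|f (rot j i0) 0 (sw j)|.
Proof. by rewrite divr_gt0 // focal_norm_gt0. Qed.

Lemma chain_mxS j l i : chain_mx j.+1 l i = if i == sw j then 0
  else chain_mx j l i
       + chain_mx j l (sw j) * (`|f (rot j i0) 0 i| / `|f (rot j i0) 0 (sw j)|).
Proof.
have -> : chain_mx j.+1 l i = (row l (chain_mx j) *m step_mx N C (rot j i0)) 0 i.
  by rewrite -row_mul [RHS]mxE.
by rewrite step_mxE !mxE.
Qed.

Lemma chain_cvS j l : chain_cv j.+1 l 0 =
  chain_cv j l 0 + chain_mx j l (sw j) / `|f (rot j i0) 0 (sw j)|.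
Proof.
rewrite [LHS]mxE; congr (_ + _).
have -> : (chain_mx j *m step_cv N C (rot j i0)) l 0 =
    weight (step_cv N C (rot j i0)) (row l (chain_mx j)).
  by rewrite /weight -row_mul [RHS]mxE.
by rewrite step_cvE mxE.
Qed.

Lemma chain_mx_ge0 j l i : 0 <= chain_mx j l i.
Proof.
elim: j i => [|j IH] i; first by rewrite mxE ler0n.
rewrite chain_mxS; case: eqP => // _.
by rewrite addr_ge0 // mulr_ge0 // ltW // ratio_gt0.
Qed.

Lemma chain_cv_ge0 j l : 0 <= chain_cv j l 0.
Proof.
elim: j => [|j IH]; first by rewrite mxE.
by rewrite chain_cvS addr_ge0 // divr_ge0 // chain_mx_ge0.
Qed.

Lemma chain_row0 j l i : l = m0 -> chain_mx j l i = 0.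
Proof.
move=> lm; elim: j i => [|j IH] i; first by rewrite mxE lm eqxx andbF.
by rewrite chain_mxS !IH mul0r addr0 if_same.
Qed.

Lemma chain_cv_row0 j l : l = m0 -> chain_cv j l 0 = 0.
Proof.
move=> lm; elim: j => [|j IH]; first by rewrite mxE.
by rewrite chain_cvS IH chain_row0 // mul0r addr0.
Qed.

Lemma chain_fixed j l : (forall i, switch C i != l) -> l != m0 ->
  (forall i, chain_mx j l i = (l == i)%:R) /\ chain_cv j l 0 = 0.
Proof.
move=> nl lm; have nsw i : (l == switch C i) = false.
  by rewrite eq_sym (negbTE (nl i)).
elim: j => [|j [IH IHc]]; first by split=> [i|]; rewrite mxE // lm andbT.
split=> [i|]; last by rewrite chain_cvS IHc IH nsw mul0r addr0.
rewrite chain_mxS !IH nsw mul0r addr0.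
by case: eqP => // ->; rewrite nsw.
Qed.

(** Until the variable [l] switches, its diagonal entry stays positive. When it
switches it feeds all other variables; from then on only the variable that has
just switched can have a zero entry, and consecutive switching variables
differ. *)
Lemma chain_positive j l : l != m0 ->
  ((forall j', (j' < j)%N -> sw j' != l) /\ 0 < chain_mx j l l) \/
  (exists j', [/\ j = j'.+1, forall i, i != sw j' -> 0 < chain_mx j l i
                & 0 < chain_cv j l 0]).
Proof.
move=> lm; elim: j => [|j IH]; first by left; split=> //; rewrite mxE eqxx lm.
have f0 := focal_norm_gt0 N C (rot j i0) (sw j).
case: IH => [[nl pos]|[j' [ej pos posc]]].
- have [e|ne] := eqVneq (sw j) l.
    right; exists j; split=> // [i im|].
      by rewrite chain_mxS (negbTE im) ltr_wpDl ?chain_mx_ge0 // mulr_gt0 ?ratio_gt0 // e.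
    by rewrite chain_cvS ltr_wpDl ?chain_cv_ge0 // divr_gt0 // e.
  left; split=> [j'|]; first by rewrite ltnS leq_eqVlt => /orP[/eqP ->|/nl].
  rewrite chain_mxS eq_sym (negbTE ne); apply: ltr_pwDl => //.
  by apply: mulr_ge0; [exact: chain_mx_ge0 | apply: ltW; exact: ratio_gt0].
- right; exists j; have psw : 0 < chain_mx j l (sw j).
    by apply: pos; rewrite ej; exact: (switch_succ_neq hC).
  split=> // [i im|].
    by rewrite chain_mxS (negbTE im) ltr_wpDl ?chain_mx_ge0 // mulr_gt0 ?ratio_gt0.
  by rewrite chain_cvS ltr_wpDl ?chain_cv_ge0 // divr_gt0.
Qed.

Definition switching : pred 'I_n := fun l => [exists i, switch C i == l].
Definition off_wall : pred 'I_n := fun l => l != m0.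
Definition active : pred 'I_n := fun l => off_wall l && switching l.

Definition cycle_map : 'rV[R]_n -> 'rV[R]_n := proj_map (chain_mx k.+1) (chain_cv k.+1).

Lemma rot_k : rot k i0 = ord0.
Proof. by rewrite -iterSr iter_ordS_period. Qed.

Lemma cycle_mx_positive l : active l ->
  (forall i, off_wall i -> 0 < chain_mx k.+1 l i) /\ 0 < chain_cv k.+1 l 0.
Proof.
move=> /andP[lm /existsP[i /eqP il]].
case: (chain_positive k.+1 lm) => [[nl _]|[j [[<-] pos posc]]].
  have [j jk e] := iter_ordS_reach i0 i.
  by have := nl j jk; rewrite e il eqxx.
by split=> // i' im; apply: pos; rewrite rot_k.
Qed.

Lemma active_nonempty : exists l, active l.
Proof.
exists (switch C i0); rewrite /active /off_wall (switch_succ_neq hC) /=.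
by apply/existsP; exists i0.
Qed.

Lemma cycle_dichotomy :
  (exists q, attracting_fixed_point off_wall cycle_map q) \/
  vanishing_on active off_wall cycle_map.
Proof.
have inactive l : off_wall l -> ~~ active l -> forall i, switch C i != l.
  by move=> lm; rewrite /active lm /= => /existsPn.
have not_off l : ~~ off_wall l -> l = m0 by move=> /negPn/eqP.
apply: (proj_map_dichotomy (P := active)).
- by move=> i /andP[].
- exact: active_nonempty.
- exact: chain_mx_ge0.
- by move=> l i /cycle_mx_positive[h _]; exact: h.
- by move=> l i lm /(inactive _ lm) nl; apply: (proj1 (chain_fixed _ nl lm)).
- by move=> l i /not_off; exact: chain_row0.
- by move=> l i /not_off ->; rewrite chain_mxS rot_k eqxx.
- by move=> l /cycle_mx_positive[].
- move=> l nl; have [lm|/not_off] := boolP (off_wall l); last exact: chain_cv_row0.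
  exact: (proj2 (chain_fixed _ (inactive _ lm nl) lm)).
Qed.

Lemma absv_wall0 (x : 'rV[R]_n) : wall0 C x -> in_cone off_wall (absv x).
Proof.
move=> [x0 xj]; split=> i im; rewrite absvE.
  by rewrite normr_gt0; apply: has_sign_neq0 (xj i im).
by move: im => /negPn/eqP ->; rewrite x0 normr0.
Qed.

Lemma absv_orbit_pt (x : 'rV[R]_n) j : wall0 C x ->
  absv (orbit_pt N C i0 x j) = proj_map (chain_mx j) (chain_cv j) (absv x).
Proof.
move=> wx; have rx := ready_entering hC (entering_wall0 wx).
have [cpos c0] := absv_wall0 wx.
elim: j => [|j IH].
  apply/rowP => i; rewrite proj_mapE.
  have -> : weight (chain_cv 0) (absv x) = 0 by rewrite /weight mulmx0 mxE.
  rewrite addr0 invr1 mul1r row_mulmxE.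
  rewrite (bigD1 i) //= mxE eqxx /= big1 ?addr0; last first.
    by move=> l /negbTE li; rewrite mxE li mulr0.
  have [Qi|/c0 ->] := boolP (off_wall i); last by rewrite mul0r.
  by rewrite [i != m0]Qi mulr1.
rewrite /= (absv_exit_point hC) ?IH; last exact: (ready_orbit_pt hC).
apply: proj_map_comp; rewrite gt_eqF // denom_gt0 //; first exact: chain_cv_ge0.
by move=> i; rewrite absvE.
Qed.

Lemma return_mapE x : wall0 C x -> ret x = orbit_pt N C i0 x k.+1.
Proof.
move=> wx; have ex := entering_wall0 wx; have rx := ready_entering hC ex.
apply: xget_unique.
  exists (orbit_time N C i0 x), (orbit_curve N C i0 x); split=> //.
  - exact: (orbit_trajectory hC).
  - exact: (orbit_curve0 hC).
  - by rewrite (orbit_curve_time hC).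
by move=> x' [t [y [_ tr <- ->]]]; case: (trajectory_orbit hC tr k.+1).
Qed.

Lemma orbit_pt_wall i x j : ready C i x ->
  cycle_wall C (rot j i) (orbit_pt N C i x j.+1).
Proof. by move=> rx; apply: (exit_point_wall hC); exact: (ready_orbit_pt hC). Qed.

Lemma return_map_wall0 x : wall0 C x -> wall0 C (ret x).
Proof.
move=> wx; rewrite return_mapE //.
have := @orbit_pt_wall i0 x k (ready_entering hC (entering_wall0 wx)).
by rewrite rot_k.
Qed.

Lemma absv_return_map x : wall0 C x -> absv (ret x) = cycle_map (absv x).
Proof. by move=> wx; rewrite return_mapE // absv_orbit_pt. Qed.

Lemma iter_return_map x j : wall0 C x ->
  wall0 C (iter j ret x) /\ absv (iter j ret x) = iter j cycle_map (absv x).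
Proof.
move=> wx; elim: j => [//|j [IHw IHa]]; split; first exact: return_map_wall0.
by rewrite iterS absv_return_map // IHa.
Qed.

Lemma orbit_pt_return x r : wall0 C x ->
  orbit_pt N C i0 x (r * k.+1) = iter r ret x.
Proof.
move=> wx; elim: r => [//|r IH].
rewrite mulSn addnC orbit_pt_add IH iter_ordS_periodM iterS return_mapE //.
by case: (iter_return_map r wx).
Qed.

(** On the wall 0 the signs are fixed, so passing to absolute values is an
isometry. *)
Lemma wall0_distr (x y : 'rV[R]_n) i : wall0 C x -> wall0 C y ->
  `|x 0 i - y 0 i| = `|absv x 0 i - absv y 0 i|.
Proof.
move=> [x0 xj] [y0 yj]; rewrite !absvE.
have [->|im] := eqVneq i m0; first by rewrite x0 y0 normr0.
by apply: has_sign_distr (xj i im) (yj i im).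
Qed.

Lemma absv_wall0_inj (x y : 'rV[R]_n) : wall0 C x -> wall0 C y -> absv x = absv y -> x = y.
Proof.
move=> wx wy e; apply/rowP => i; apply/eqP; rewrite -subr_eq0 -normr_eq0.
by rewrite wall0_distr // e subrr normr0.
Qed.

Definition signed_pt (u : 'rV[R]_n) : 'rV[R]_n := \row_i (sgb R (region C ord0 i) * u 0 i).

Lemma signed_pt_wall0 u : in_cone off_wall u -> wall0 C (signed_pt u) /\ absv (signed_pt u) = u.
Proof.
move=> uc; have u_ge0 := in_cone_nonneg uc; have [upos u0] := uc; split; first split.
- by rewrite mxE u0 ?mulr0 // /off_wall eqxx.
- by move=> j jm; apply/has_signE; rewrite mxE mulrA sgbK mul1r upos.
- by apply/rowP => i; rewrite absvE mxE normr_sgbM ger0_norm.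
Qed.

(** Two walls that share a point have the same switching variable, and then the
regions before them differ at most in that coordinate. If they differ, then the
second is the region after the wall 0, which cannot switch the same variable
again. *)
Lemma wall0_cycle_wall i (x : 'rV[R]_n) : wall0 C x -> cycle_wall C i x -> i = ord0.
Proof.
move=> [x0 xj] [xi0 xij].
have e : switch C i = m0.
  apply/eqP/negPn/negP => ne; have := has_sign_neq0 (xj _ ne).
  by rewrite xi0 eqxx.
have same j : j != m0 -> region C i j = region C ord0 j.
  by move=> jm; apply: has_sign_inj (xj j jm); apply: xij; rewrite e.
have inj := cycle_distinct (proj1 hC).
have [em|em] := eqVneq (region C i m0) (region C ord0 m0).
  apply: inj; apply/ffunP => j.
  by have [->|/same] := eqVneq j m0.
have ii0 : i = i0.
  apply: inj; apply/ffunP => j; have [->|jm] := eqVneq j m0.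
    by rewrite (region_flip hC); move: em; case: (region C i _); case: (region C ord0 _).
  by rewrite (region_succ hC) // same.
by have := switch_succ_neq hC ord0; rewrite -ii0 e eqxx.
Qed.

Lemma wall0_cycle_orthant i (x : 'rV[R]_n) : wall0 C x -> ~ cycle_orthant C i x.
Proof. by move=> [x0 _] /(_ m0) /has_sign_neq0; rewrite x0 eqxx. Qed.

End ReturnMap.

(** * Periodic orbits and the spine *)

Section RowNorm.
Variables (R : realType) (n : nat).
Implicit Types x : 'rV[R]_n.

Lemma row_norm_lt x e : 0 < e -> (forall i, `|x 0 i| < e) -> `|x| < e.
Proof.
move=> e0 h; rewrite [ltLHS]/Num.Def.normr /= mx_normrE; apply/bigmax_ltP; split=> // -[a i] _ /=.
by rewrite [a]ord1; exact: h.
Qed.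

Lemma row_norm_ge x i : `|x 0 i| <= `|x|.
Proof.
by rewrite [leRHS]/Num.Def.normr /= mx_normrE; apply/bigmax_geP; right => /=; exists (0, i).
Qed.

End RowNorm.

Section Spine.
Variables (R : realType) (n k : nat) (N : glass_network R n) (C : region_cycle n k).
Hypothesis hC : cyclic_attractor N C.

Local Notation f := (cycle_focal N C).
Local Notation rot j i := (iter j (@ordS k.+1) i).
Local Notation i0 := (ordS (@ord0 k)).
Local Notation m0 := (switch C ord0).
Local Notation ret := (return_map N C).
Local Notation sg i j := (@sgb R (region C i j)).

Definition transit_factor (kappa : R) :=
  forall i (x : 'rV[R]_n) (t e : R), ready C i x -> 0 <= t <= exit_time N C i x ->
    (forall l, switching C l -> `|x 0 l| <= e) ->
    forall l, switching C l -> `|flow (f i) x t 0 l| <= kappa * e.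

(** All moves within a region are governed by the exiting coordinate, which is
itself a switching one. *)
Lemma exists_transit_factor : exists kappa, 1 <= kappa /\ transit_factor kappa.
Proof.
have [b [b1 Hb]] := @finite_upper_bound R _
  (fun p : 'I_k.+1 * 'I_n => `|f p.1 0 p.2| / `|f p.1 0 (switch C p.1)|).
exists (1 + b); split=> [|i x t e rx ht small l sl]; first by lra.
have sm : `|x 0 (switch C i)| <= e by apply: small; apply/existsP; exists i.
apply: (le_trans (flow_coord_bound l rx ht)); rewrite mulrDl mul1r.
apply: lerD; first exact: small.
rewrite mulrC; apply: ler_pM => //; exact: (Hb (i, l)).
Qed.

Lemma orbit_pt_small (kappa e : R) i (x : 'rV[R]_n) : 1 <= kappa -> ready C i x ->
  transit_factor kappa ->
  (forall l, switching C l -> `|x 0 l| <= e) ->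
  forall r l, switching C l -> `|orbit_pt N C i x r 0 l| <= kappa ^+ r * e.
Proof.
move=> k1 rx transit small; elim=> [|r IH] l sl; first by rewrite mul1r small.
have rr := ready_orbit_pt hC r rx.
rewrite exprS -mulrA; apply: transit => //.
by rewrite lexx andbT ltW // exit_time_gt0.
Qed.

Lemma region_unswitched i l : ~~ switching C l -> region C i l = region C ord0 l.
Proof.
move=> nl; have [j _ <-] := iter_ordS_reach ord0 i.
elim: j => [//|j IH]; rewrite iterS (region_succ hC) //.
by apply: contraNneq nl => ->; apply/existsP; eexists.
Qed.

Lemma signed_flow_ge0 i x t l : ready C i x -> 0 <= t -> l != switch C i ->
  0 <= sg i l * flow (f i) x t 0 l.
Proof.
move=> rx t0 lm; rewrite (signed_flow hC) // (negbTE lm).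
have : expR (- t) <= 1 by rewrite -[leRHS]expR0 ler_expR oppr_le0.
by move=> h; rewrite addr_ge0 // mulr_ge0 ?expR_ge0 // subr_ge0.
Qed.

(** A point of the spine is approached from a given wall by moving every
coordinate but the switching one slightly to the side prescribed by the wall. *)
Lemma mem_spine (z : 'rV[R]_n) : (forall l, switching C l -> z 0 l = 0) ->
  (forall l, ~~ switching C l -> 0 <= sg ord0 l * z 0 l) -> spine C z.
Proof.
move=> zs zn i _ V /nbhs_ballP[e /= e0 zV].
pose w : 'rV[R]_n := \row_l (if l == switch C i then 0 else z 0 l + sg i l * (e / 2)).
exists w; split; first split.
- by rewrite mxE eqxx.
- move=> l lm; apply/has_signE; rewrite mxE (negbTE lm) mulrDr mulrA sgbK mul1r.
  apply: ltr_wpDl; last by rewrite divr_gt0.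
  have [/zs ->|nl] := boolP (switching C l); first by rewrite mulr0.
  by rewrite region_unswitched // zn.
- apply: zV; rewrite -ball_normE /ball_ /=; apply: row_norm_lt => // l; rewrite !mxE.
  have [->|lm] := eqVneq l (switch C i).
    rewrite zs ?subr0 ?normr0 //; by apply/existsP; exists i.
  rewrite opprD addNKr normrN normr_sgbM ger0_norm ?divr_ge0 ?ltW //.
  by rewrite ltr_pdivrMr // ltr_pMr // ltr1n.
Qed.

Lemma near_spine (y : 'rV[R]_n) (e : R) : 0 < e ->
  (forall l, switching C l -> `|y 0 l| < e) ->
  (forall l, ~~ switching C l -> 0 <= sg ord0 l * y 0 l) ->
  exists2 z, spine C z & `|y - z| < e.
Proof.
move=> e0 ys yn; pose z : 'rV[R]_n := \row_l (if switching C l then 0 else y 0 l).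
exists z; last first.
  apply: row_norm_lt => // l; rewrite !mxE; case: ifP => [/ys|_]; first by rewrite subr0.
  by rewrite subrr normr0.
apply: mem_spine => l sl; rewrite mxE; first by rewrite sl.
by rewrite (negbTE sl) yn.
Qed.

Lemma trajectory_shift_wall0 i t y : trajectory N C i t y ->
  exists a, [/\ trajectory N C i0 (fun j => t (a + j)%N - t a) (fun s => y (s + t a)),
    wall0 C (y (t a)) & 0 <= t a].
Proof.
move=> tr; have [j0 _ e] := iter_ordS_reach i ord0.
exists j0.+1; split.
- by have := trajectory_shift j0 tr; rewrite iterS e.
- by have := traj_wall tr j0; rewrite e.
- by rewrite -(traj_time0 tr); apply: increasing_homo => // j; exact: (traj_time_lt tr).
Qed.

(** At the successive returns the switching coordinates tend to 0, and the at most
[k.+1] crossings since the last return amplify them by at most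
[kappa ^+ k.+1]. *)
Lemma spine_convergence_from_wall0 t y :
  vanishing_on (active C) (off_wall C) (cycle_map N C) ->
  trajectory N C i0 t y -> wall0 C (y 0) -> converges_to_spine C t y.
Proof.
move=> vanish tr w0 e e0; have [kappa [k1 transit]] := exists_transit_factor.
have K0 : 0 < kappa ^+ k.+1 by rewrite exprn_gt0 //; lra.
have eps0 : 0 < e / 2 / kappa ^+ k.+1 by rewrite !divr_gt0.
set eps := e / 2 / kappa ^+ k.+1 in eps0.
have [L HL] := vanish _ _ (absv_wall0 w0) eps0.
have tS := traj_time_lt tr; have tH := increasing_homo tS.
have t0 := traj_time0 tr.
exists (t (L * k.+1)%N); split.
- by rewrite -t0 tH.
- by apply/end_timeP; exists (L * k.+1).+1.
move=> s sL /end_timeP[J sJ].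
have [|j _ /andP[js sj]] := @switching_interval R t s J.
  by rewrite sJ andbT; apply: le_trans sL; exact: tH.
have Lj : (L * k.+1 <= j)%N.
  rewrite leqNgt; apply/negP => /tH h.
  by have := lt_le_trans sj (le_trans h sL); rewrite ltxx.
have [yj tj] := trajectory_orbit hC tr j.
have [_ tj1] := trajectory_orbit hC tr j.+1.
have rx0 := ready_entering hC (entering_wall0 w0).
have rxj := ready_orbit_pt hC j rx0.
have ys : y s = flow (f (rot j i0)) (orbit_pt N C i0 (y 0) j) (s - t j).
  by rewrite -yj; apply: (traj_flow tr); rewrite js ltW.
have ht : 0 <= s - t j <= exit_time N C (rot j i0) (orbit_pt N C i0 (y 0) j).
  by rewrite subr_ge0 js lerBlDl tj -/(orbit_time N C i0 (y 0) j.+1) -tj1 ltW.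
pose l := (j %/ k.+1)%N; pose r := (j %% k.+1)%N.
have jE : j = (l * k.+1 + r)%N by rewrite -divn_eq.
have rk : (r < k.+1)%N by rewrite ltn_mod.
have Ll : (L <= l)%N by rewrite leq_divRL.
have [wl al] := iter_return_map hC l w0.
have start_small m : switching C m -> `|iter l ret (y 0) 0 m| <= eps.
  move=> sm; have [->|mm] := eqVneq m m0.
    by rewrite (proj1 wl) normr0 ltW.
  by rewrite -absvE al; apply: HL => //; rewrite /active /off_wall mm.
have small m : switching C m -> `|y s 0 m| < e.
  move=> sm; rewrite ys.
  apply: (@le_lt_trans _ _ (kappa * (kappa ^+ r * eps))).
    apply: (transit) => // m' sm'; rewrite jE orbit_pt_add iter_ordS_periodM.
    rewrite (orbit_pt_return hC) //.
    exact: (orbit_pt_small k1 (ready_entering hC (entering_wall0 wl)) transit start_small).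
  rewrite mulrA -exprS; apply: (@le_lt_trans _ _ (kappa ^+ k.+1 * eps)).
    by rewrite ler_pM2r // ler_weXn2l.
  by rewrite /eps mulrC divfK ?gt_eqF // ltr_pdivrMr // ltr_pMr // ltr1n.
apply: near_spine => // m nm.
rewrite -(region_unswitched (rot j i0) nm) ys; apply: signed_flow_ge0 => //.
  by rewrite subr_ge0.
by apply: contraNneq nm => ->; apply/existsP; eexists.
Qed.

Lemma spine_convergence i t y :
  vanishing_on (active C) (off_wall C) (cycle_map N C) ->
  trajectory N C i t y -> converges_to_spine C t y.
Proof.
move=> vanish tr e e0; have [a [tr' w0 ta0]] := trajectory_shift_wall0 tr.
have tS := traj_time_lt tr.
have [|s0 [s00 s0T conv]] := spine_convergence_from_wall0 vanish tr' _ e0.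
  by rewrite add0r.
exists (s0 + t a); split; first exact: addr_ge0.
  by apply/(end_time_shift a _ tS); rewrite addrK.
move=> s; rewrite -lerBrDr => h1 /(end_time_shift a _ tS) h2.
by have [z zS zd] := conv _ h1 h2; exists z => //; move: zd; rewrite subrK.
Qed.

End Spine.

Section PeriodicOrbit.
Variables (R : realType) (n k : nat) (N : glass_network R n) (C : region_cycle n k).
Hypothesis hC : cyclic_attractor N C.

Local Notation rot j i := (iter j (@ordS k.+1) i).
Local Notation i0 := (ordS (@ord0 k)).
Local Notation ret := (return_map N C).

Section FixedPoint.
Variable q : 'rV[R]_n.
Hypothesis q_wall : wall0 C q.
Hypothesis q_fixed : ret q = q.

Local Notation T := (orbit_time N C i0 q).
Local Notation y := (orbit_curve N C i0 q).

Let q_ready : ready C i0 q. Proof. exact: (ready_entering hC (entering_wall0 q_wall)). Qed.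
Let T_lt j : T j < T j.+1. Proof. exact: orbit_time_lt. Qed.

Lemma period_gt0 : 0 < T k.+1.
Proof. by apply: lt_le_trans (T_lt 0) _; apply: (increasing_homo T_lt). Qed.

Lemma orbit_pt_periodic j : orbit_pt N C i0 q (k.+1 + j) = orbit_pt N C i0 q j.
Proof. by rewrite orbit_pt_add iter_ordS_period -return_mapE // q_fixed. Qed.

Lemma orbit_time_periodic j : T (k.+1 + j) = T k.+1 + T j.
Proof. by rewrite orbit_time_add iter_ordS_period -return_mapE // q_fixed. Qed.

Lemma orbit_time_unbounded (s : R) : exists j, s < T j.
Proof.
have p0 := period_gt0.
have TM r : T (r * k.+1) = r%:R * T k.+1.
  elim: r => [|r IH]; first by rewrite mul0r.
  by rewrite mulSn orbit_time_periodic IH -natr1 mulrDl mul1r addrC.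
have [s0|s0] := ltP s 0; first by exists 0%N.
exists ((Num.trunc (s / T k.+1)).+1 * k.+1)%N; rewrite TM -ltr_pdivrMr //.
by have /andP[] := trunc_itv (divr_ge0 s0 (ltW p0)).
Qed.

Lemma end_time_periodic : end_time T = +oo%E.
Proof.
by apply: eq_infty => s; apply/ltW/end_timeP; exact: orbit_time_unbounded.
Qed.

Lemma orbit_curve_periodic s : 0 <= s -> y (s + T k.+1) = y s.
Proof.
move=> s0; have [J sJ] := orbit_time_unbounded s.
have [|j _ /andP[h1 h2]] := @switching_interval R T s J; first by rewrite sJ s0.
rewrite (orbit_curveE hC (j := j) (s := s) q_ready) ?h1 ?ltW //.
rewrite (orbit_curveE hC (j := (k.+1 + j)%N) q_ready); last first.
  by rewrite -addnS !orbit_time_periodic [s + _]addrC !lerD2l h1 ltW.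
rewrite orbit_pt_periodic orbit_time_periodic addnC iterD iter_ordS_period.
by congr flow; ring.
Qed.

Definition orbit_of_fixed : set 'rV[R]_n := y @` [set s | 0 <= s].

Lemma orbit_of_fixed_periodic : periodic_orbit N C orbit_of_fixed.
Proof.
exists i0, T, y, (T k.+1); split=> //.
- apply: orbit_trajectory => //; exact: entering_wall0.
- exact: end_time_periodic.
- exact: period_gt0.
- exact: orbit_curve_periodic.
Qed.

(** One period after visiting the wall 0 in [x], the orbit is on the wall 0
again, at the same point; interior points of regions and other walls being
excluded, this is a switching time of index [r * k.+1], so [x] is fixed by the
[r]-th iterate of the return map. As the iterates of [x] tend to [q], this
gives [x = q]. *)
Lemma periodic_orbit_unique :
  (forall x, wall0 C x -> forall e, 0 < e -> exists J, forall j, (J <= j)%N ->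
     forall l, `|iter j ret x 0 l - q 0 l| <= e) ->
  forall G, periodic_orbit N C G -> G = orbit_of_fixed.
Proof.
move=> attract G [i [t [z [p [tr tinf p0 per ->]]]]].
have [a [tr' w0 ta0]] := trajectory_shift_wall0 tr.
have tS := traj_time_lt tr.
have perM r s : 0 <= s -> z (s + r%:R * p) = z s.
  move=> s0; elim: r => [|r IH]; first by rewrite mul0r addr0.
  rewrite -natr1 mulrDl mul1r addrA per ?IH // addr_ge0 // mulr_ge0 //; exact: ltW.
pose t' j := t (a + j)%N - t a; pose z' s := z (s + t a).
rewrite -/t' -/z' in tr'.
have z'0 : z' 0 = z (t a) by rewrite /z' add0r.
have w0' : wall0 C (z' 0) by rewrite z'0.
have t'inf s : (s%:E < end_time t')%E.
  have := (end_time_shift a (s + t a) tS).1; rewrite addrK; apply.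
  by rewrite tinf ltry.
(* Only one period is needed: [p] is a switching time at which the wall 0 is hit. *)
have z'p : z' p = z' 0 by rewrite /z' add0r addrC per.
have [r r0 fix_r] : exists2 r, (0 < r)%N & iter r ret (z' 0) = z' 0.
  have [J pJ] := (end_timeP t' p).1 (t'inf p).
  have [|j _ /andP[h1 h2]] := @switching_interval R t' p J.
    by rewrite pJ (traj_time0 tr') ltW.
  move: h1; rewrite le_eqVlt => /orP[/eqP e|lt]; last first.
    have := traj_region tr' (j := j) (s := p); rewrite lt h2 => /(_ isT).
    by rewrite z'p => /(wall0_cycle_orthant w0').
  case: j e h2 => [e _|j e _]; first by move: p0; rewrite -e (traj_time0 tr') ltxx.
  have := traj_wall tr' j; rewrite e z'p => /(wall0_cycle_wall hC w0').
  rewrite -iterSr => /iter_ordS_fixed /dvdnP[r er].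
  exists r; first by case: r er.
  by rewrite -(orbit_pt_return hC) // -er -(proj1 (trajectory_orbit hC tr' j.+1)) e z'p.
have z'0q : z' 0 = q.
  have fixM m : iter (m * r) ret (z' 0) = z' 0.
    by elim: m => // m IH; rewrite mulSn iterD IH.
  apply/rowP => l; apply/eqP; rewrite -subr_eq0 -normr_eq0 eq_le normr_ge0 andbT.
  apply/ler_addgt0Pr => e e0; rewrite add0r.
  have [J HJ] := attract _ w0' _ e0.
  by have := HJ (J * r)%N (leq_pmulr _ r0) l; rewrite fixM.
have z'y s : 0 <= s -> z' s = y s.
  have try := orbit_trajectory hC (entering_wall0 q_wall).
  have e : z' 0 = y 0 by rewrite (orbit_curve0 hC).
  by move=> s0; have [_ h] := trajectory_unique hC tr' try e; exact: h.
apply/seteqP; split=> x [s /= s0 <-].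
(* Points of the orbit before the time [t a] are met again [m] periods later. *)
- pose m := (Num.trunc (t a / p)).+1.
  have mp : t a <= m%:R * p.
    rewrite -ler_pdivrMr //; apply: ltW.
    by have /andP[] := trunc_itv (divr_ge0 ta0 (ltW p0)).
  have s'0 : 0 <= s + m%:R * p - t a by rewrite subr_ge0 ler_wpDl.
  exists (s + m%:R * p - t a) => //.
  by rewrite -z'y // /z' subrK perM.
- by exists (s + t a); [rewrite /= addr_ge0 | rewrite -z'y].
Qed.

Lemma orbit_of_fixed_stable :
  (forall e, 0 < e -> exists2 d, 0 < d & forall x, wall0 C x ->
     (forall l, `|x 0 l - q 0 l| <= d) ->
     forall j l, `|iter j ret x 0 l - q 0 l| <= e) ->
  (forall x, wall0 C x -> forall e, 0 < e -> exists J, forall j, (J <= j)%N ->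
     forall l, `|iter j ret x 0 l - q 0 l| <= e) ->
  stable_orbit N C orbit_of_fixed.
Proof.
have half (e : R) : 0 < e -> e / 2 < e by lra.
move=> stable attract; exists q; split=> //.
  by exists 0; rewrite /= ?(orbit_curve0 hC).
split=> [e e0|].
  have e20 : 0 < e / 2 by rewrite divr_gt0.
  have [d d0 Hd] := stable _ e20.
  apply/nbhs_ballP; exists d => //= x; rewrite -ball_normE /ball_ /= => xd wx j.
  apply: row_norm_lt => // l; rewrite !mxE; apply: le_lt_trans (half _ e0).
  apply: Hd => // {}l; apply: le_trans (ltW xd); rewrite distrC.
  by have := row_norm_ge (q - x) l; rewrite !mxE.
rewrite near_withinE; apply: nearW => x wx; apply/cvgrPdist_lt => e e0.
have e20 : 0 < e / 2 by rewrite divr_gt0.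
have [J HJ] := attract x wx _ e20.
exists J => // j /= Jj; apply: row_norm_lt => // l.
by rewrite !mxE distrC; apply: le_lt_trans (half _ e0); exact: HJ.
Qed.

End FixedPoint.

End PeriodicOrbit.

Theorem theorem5p3 (R : realType) (n k : nat) (N : glass_network R n)
    (C : region_cycle n k) (hC : cyclic_attractor N C) :
  (exists G : set 'rV[R]_n,
     [/\ periodic_orbit N C G, stable_orbit N C G &
         forall G', periodic_orbit N C G' -> G' = G])
  \/
  (forall i t y, trajectory N C i t y -> converges_to_spine C t y).
Proof.
have [[u [u_cone u_fixed stable attract]]|vanish] := cycle_dichotomy hC; last first.
  by right=> i t y; exact: spine_convergence.
left; have [q_wall q_abs] := signed_pt_wall0 u_cone.
set q := signed_pt C u in q_wall q_abs.
have q_fixed : return_map N C q = q.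
  apply: (absv_wall0_inj (return_map_wall0 hC q_wall) q_wall).
  by rewrite absv_return_map // q_abs.
have coordE x j l : wall0 C x ->
    `|iter j (return_map N C) x 0 l - q 0 l| =
    `|iter j (cycle_map N C) (absv x) 0 l - u 0 l|.
  move=> wx; have [wj aj] := iter_return_map hC j wx.
  by rewrite (wall0_distr _ wj q_wall) q_abs aj.
have attract_q x : wall0 C x -> forall e, 0 < e -> exists J, forall j, (J <= j)%N ->
    forall l, `|iter j (return_map N C) x 0 l - q 0 l| <= e.
  move=> wx e e0; have [J HJ] := attract _ _ (absv_wall0 wx) e0.
  by exists J => j Jj l; rewrite coordE // HJ.
exists (orbit_of_fixed N C q); split.
- exact: orbit_of_fixed_periodic.
- apply: orbit_of_fixed_stable => // e /stable[d d0 Hd]; exists d => // x wx close j l.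
  rewrite coordE //; apply: Hd; first exact: absv_wall0.
  by move=> {}l; rewrite -q_abs -(wall0_distr _ wx q_wall).
- exact: periodic_orbit_unique.
Qed.
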